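(* There exists $\mu \in \mathcal{M}(S;X)$ that minimizes the problem $$\inf_{\mu \in \mathcal{M}(S;X)} \tfrac12\|A\mu(S)-f\|_Y^2 + \alpha\int_S J\left(\tfrac{\mu}{|\mu|}(s),s\right)d|\mu|(s).$$
   Context: Setting: $X$ is a separable (real) Banach space that admits a predual $X_*$; $Y$ is a separable Hilbert space; $A : X \to Y$ is linear and weak*-to-weak continuous (i.e. the adjoint of some bounded linear operator $A_*: Y \to X_*$); $f \in Y$; $\alpha>0$; $S \subset \mathbb{R}^d$ ($d\in\mathbb{N}$) is non-empty and compact; $J : X \times S \to [0,+\infty]$ is a proper Borel-measurable functional satisfying: (H1) for every $s \in S$, $J(\cdot,s)$ is proper, convex and positively one-homogeneous, i.e. $J(\lambda v,s) = \lambda J(v,s)$ for all $\lambda \ge 0$, $v \in X$ (with $0\cdot(+\infty)=0$); (H2) $J$ is sequentially lower semicontinuous on $X \times S$, where $X$ carries the weak* topology; (H3) there is a constant $C>0$ with $\|v\|_X \le C J(v,s)$ for all $v \in X$, $s \in S$. Vector measures: $\mathcal{M}(S;X)$ is the space of countably additive (in norm) $X$-valued Borel measures $\mu$ on $S$ with finite variation, where $|\mu|(E) = \sup\{\sum_{i=1}^n \|\mu(A_i)\|_X : n\in\mathbb{N}, (A_i)_{i=1}^n \text{ Borel partition of } E\}$. Since $X$ is a separable dual space it has the Radon–Nikodým property, so every $\mu \in \mathcal{M}(S;X)$ has a density $\frac{\mu}{|\mu|} \in L^1((S,|\mu|);X)$ (Bochner space), defined $|\mu|$-a.e. by $\mu(E)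 = \int_E \frac{\mu}{|\mu|}(s)\,d|\mu|(s)$ for all Borel $E\subset S$. *)

(* Defs.v *)
From mathcomp Require Import all_boot all_order all_algebra.
From mathcomp Require Import all_classical all_reals all_analysis.
From mathcomp Require Import measurable_realfun.

Set Implicit Arguments.
Unset Strict Implicit.
Unset Printing Implicit Defensive.

Import Order.TTheory GRing.Theory Num.Theory.
Import numFieldNormedType.Exports.

Local Open Scope classical_set_scope.
Local Open Scope ring_scope.

Definition separable (T : topologicalType) : Prop :=
  exists2 D : set T, countable D & dense D.

Definition borel (T : topologicalType) := g_sigma_algebraType (@open T).

Section Duality.
Context (R : realType).

(* x |-> pairing x is an isometric isomorphism of X onto the dual of Xs. *)
Definition is_predual (X Xs : normedModType R)
    (pairing : {bilinear X -> Xs -> R | *%R & *%R}) : Prop :=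
  [/\ forall x, continuous (pairing x : Xs -> R),
      forall phi : {linear Xs -> R^o}, continuous phi ->
        exists x, forall u, pairing x u = phi u
    & forall x, `|x| = sup [set `|pairing x u| | u in [set u | `|u| <= 1]] ].

Definition weak_star (X Xs : normedModType R)
    (pairing : {bilinear X -> Xs -> R | *%R & *%R}) :=
  initial_topology (fun x : X => (pairing x : {ptws Xs -> R})).

Definition topological_dual (Y : normedModType R) :=
  {phi : {linear Y -> R^o} | continuous phi}.

Definition weak (Y : normedModType R) :=
  initial_topology
    (fun y : Y => ((fun phi => sval phi y) : {ptws topological_dual Y -> R})).

Definition weak_star_weak_continuous (X Xs Y : normedModType R)
    (pairing : {bilinear X -> Xs -> R | *%R & *%R}) (A : X -> Y) : Prop :=
  continuous (A : weak_star pairing -> weak Y).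

Definition is_hilbert (Y : completeNormedModType R)
    (ip : {dot Y for (@idfun R)}) : Prop :=
  forall y : Y, `|y| ^+ 2 = ip y y.

End Duality.

Section Bochner.
Context d (T : measurableType d) (R : realType) (X : normedModType R).
Implicit Types (m : set T -> \bar R) (E : set T) (g h : T -> X).

Definition simple_function h : Prop :=
  finite_set (range h) /\ forall x, measurable (h @^-1` [set x]).

Definition simple_integral m E h : X :=
  \sum_(x \in range h) fine (m (E `&` h @^-1` [set x])) *: x.

Definition strongly_measurable E g : Prop :=
  exists2 h : nat -> T -> X, forall n, simple_function (h n) &
    forall t, E t -> h ^~ t @ \oo --> g t.

(* Every class of the Bochner space L^1(m; X) has a representative that is a
   limit of simple functions everywhere on E, not only m-a.e. *)
Definition bochner_integrable m E g : Prop :=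
  strongly_measurable E g /\ (\int[m]_(t in E) `|g t|%:E < +oo)%E.

Definition is_bochner_integral m E g (x : X) : Prop :=
  exists h : nat -> T -> X,
    [/\ forall n, simple_function (h n),
        (fun n => \int[m]_(t in E) `|g t - h n t|%:E)%E @ \oo --> 0%E
      & (fun n => simple_integral m E (h n)) @ \oo --> x].

End Bochner.

(* A vector measure on S is a function on all subsets of the ambient space; only
   its values at the measurable subsets of S are constrained or used. *)
Section VectorMeasures.
Context d (T : measurableType d) (R : realType) (X : normedModType R).
Implicit Types (S E : set T) (mu : set T -> X) (g : T -> X).

Definition countably_additive S mu : Prop :=
  forall F : nat -> set T,
    (forall i, measurable (F i)) -> (forall i, F i `<=` S) ->
    trivIset setT F ->
    (fun n => \sum_(i < n) mu (F i)) @ \oo --> mu (\bigcup_i F i).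

(* |mu| is extended by |mu|(E) = |mu|(E `&` S) to the ambient space, since the
   integral is taken with respect to a set function on the whole space. It is
   meaningful for measurable E only. *)
Definition variation S mu E : \bar R :=
  ereal_sup [set x | exists n (A : 'I_n -> set T),
    [/\ forall i, measurable (A i), trivIset setT A,
        \bigcup_i A i = E `&` S
      & x = (\sum_(i < n) `|mu (A i)|)%:E] ].

Definition vector_measures S : set (set T -> X) :=
  [set mu | countably_additive S mu /\ (variation S mu S < +oo)%E].

Definition is_density S mu g : Prop :=
  bochner_integrable (variation S mu) S g /\
  forall E, measurable E -> E `<=` S ->
    is_bochner_integral (variation S mu) E g (mu E).

(* mu / |mu|; the default value is relevant only if mu has no density, which
   does not happen when X has the Radon-Nikodym property. *)
Definition density S mu : T -> X := xget (fun=> 0) [set g | is_density S mu g].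

End VectorMeasures.

Section Functional.
Context d (T : measurableType d) (R : realType) (X Y : normedModType R).

Definition objective (S : set T) (A : X -> Y) (f : Y) (alpha : R)
    (J : X -> T -> \bar R) (mu : set T -> X) : \bar R :=
  ((2^-1 * `|A (mu S) - f| ^+ 2)%:E +
   alpha%:E * \int[variation S mu]_(s in S) J (density S mu s) s)%E.

End Functional.

Section Integrand.
Context (R : realType) (X : lmodType R).
Implicit Type j : X -> \bar R.

Definition proper_efun j : Prop := exists v, (j v < +oo)%E.

Definition convex_efun j : Prop := forall (t : R) v w, 0 <= t <= 1 ->
  (j (t *: v + (1 - t) *: w)%R <= t%:E * j v + (1 - t)%:E * j w)%E.

(* 0 * +oo = 0 in \bar R *)
Definition positively_homogeneous j : Prop := forall (l : R) v, 0 <= l ->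
  j (l *: v) = (l%:E * j v)%E.

End Integrand.

Definition seq_lsc (W V : topologicalType) (R : realType) (S : set V)
    (J : W -> V -> \bar R) : Prop :=
  forall (v_ : nat -> W) (v : W) (s_ : nat -> V) (s : V),
    (forall n, S (s_ n)) -> S s -> v_ @ \oo --> v -> s_ @ \oo --> s ->
    (J v s <= limn_einf (fun n => J (v_ n) (s_ n)))%E.

Arguments seq_lsc W {V R} S J.

(* Main.v *)
(* The direct method, with Helly's selection principle in place of the weak*
   compactness of the dual of C(S; Xs).
   - Duality: J(., s) is the supremum of the functionals <., w_i> over the i with
     s \in S_i, for countably many w_i in Xs and Borel sets S_i.  This yields
     measurability and, below, Jensen's inequality.
   - Radon-Nikodym: the scalar measures <nu(.), u_i>, for a norming sequence u_i,
     have densities, which are a.e. the coordinates of a point of the unit ball,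
     since no rational combination of the u_i separates them from that ball.
   - Compactness: a vector measure is traded for finitely many atoms (x_i, s_i)
     with almost the same total mass and no larger energy.  Rescaled atoms are the
     values of a step function on [0, 1[.  Ordered lexicographically along
     countably many cells that separate the points of (ball of X) x S, these step
     functions converge, along a subsequence and off a countable set, weakly* in X
     and in S, to some (v, s).
   - The minimizer is mu(E) = \int_{s(t) \in E} v(t) dt: Fatou's lemma bounds the
     integral of J(v(t), s(t)), and Jensen's inequality passes to the density of mu. *)
From HB Require Import structures.
Require Import Defs.
From mathcomp Require Import finmap.
From mathcomp Require Import all_boot all_order all_algebra.
From mathcomp Require Import all_classical all_reals all_analysis.
From mathcomp Require Import measurable_realfun.
From mathcomp Require Import lra ring.

Set Implicit Arguments.
Unset Strict Implicit.
Unset Printing Implicit Defensive.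

Import Order.TTheory GRing.Theory Num.Theory.
Import numFieldNormedType.Exports.

Local Open Scope classical_set_scope.
Local Open Scope ring_scope.

(** Lower semicontinuity of [J] concerns convergent pairs (x_n, s_n), and weak* convergence of
    measures offers no such pairs. The passage to step functions is a Skorokhod-type representation:
    it realizes all the discrete measures on one probability space, [0, 1[ with Lebesgue measure,
    where the atoms themselves converge and Fatou's lemma applies. Atoms are preferred to densities
    because a finite list can be sorted, and because every preimage under a step function is
    measurable, so that arbitrary functions of the atoms can be integrated. Other measurability
    questions are settled by pairings with countably many elements of Xs. In the limit, many vectors
    may sit over the same point s; convexity allows them to be averaged into the density of mu.
    Coercivity bounds the total mass of the atoms and so confines the rescaled atoms to one ball.
    The data term is handled by its tangent at the limit: |y + h|^2 >= |y|^2 + 2 <y, h>, whose right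
    side converges when h tends weakly to 0. *)

(** * Subsequences and ultrafilters *)

Lemma ultra_bounded_nat (U : set_system nat) (f : nat -> nat) b :
  UltraFilter U -> (forall n, f n <= b)%N -> exists c, U [set n | f n = c].
Proof.
move=> UU; elim: b f => [|b IH] f fb.
  exists 0%N; apply: filterE => n /=; apply/eqP; by rewrite -leqn0.
case: (in_ultra_setVsetC [set n | f n = b.+1] UU) => [Ub|Ub]; first by exists b.+1.
have [n|c Uc] := IH (fun n => minn (f n) b); first by rewrite geq_minr.
exists c; apply: filterS2 Ub Uc => n /= fnb <-.
by apply/esym/minn_idPl; rewrite -ltnS ltn_neqAle fb andbT; apply/eqP.
Qed.

(** One ultrafilter finer than [\oo] fixes all the limit values [c i] at once. Finitely many of the
    events [a i n = c i] hold jointly on a large set, and a large set contains indices beyond any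
    bound; this replaces nested extractions. *)
Lemma diagonal_subsequence (a : nat -> nat -> nat) (b : nat -> nat) :
  (forall i n, a i n <= b i)%N ->
  exists2 sigma : nat -> nat, {homo sigma : m n / (m < n)%N} &
    forall i, exists c, \forall n \near \oo, a i (sigma n) = c.
Proof.
move=> ab.
have [U [UU oU]] := @ultraFilterLemma nat \oo _.
have /choice[c cP] : forall i, exists c, U [set n | a i n = c].
  by move=> i; exact: ultra_bounded_nat (ab i).
have UG k : U [set n | forall i, (i < k)%N -> a i n = c i].
  elim: k => [|k IH]; first by apply: filterE => n i.
  apply: filterS2 IH (cP k) => n /= IH ak i.
  by rewrite ltnS leq_eqVlt => /predU1P[->//|]; exact: IH.
have step km : exists n, (km.2 < n)%N /\ forall i, (i < km.1)%N -> a i n = c i.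
  have Um : U [set n | (km.2 < n)%N] by apply: oU; exists km.2.+1.
  by have [n []] := filter_ex (filterI Um (UG km.1)); exists n.
have [h hP] := choice step.
(* At stage k the sequences with index below k already have their final value, so [a i] is constant
   along [sigma] from n = i + 1 on. *)
pose sigma := fix s k := if k is k'.+1 then h (k, s k') else 0%N.
exists sigma.
  apply: homo_ltn => [|n]; first exact: ltn_trans.
  by have [] := hP (n.+1, sigma n).
move=> i; exists (c i); exists i.+1 => // -[//|n] /= ltin.
by have [_ ->] := hP (n.+1, sigma n).
Qed.

Lemma subseq_ge (sigma : nat -> nat) :
  {homo sigma : m n / (m < n)%N} -> forall n, (n <= sigma n)%N.
Proof. by move=> h; elim=> // n IH; apply: leq_ltn_trans IH _; exact: h. Qed.

Lemma cvg_subseq (sigma : nat -> nat) :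
  {homo sigma : m n / (m < n)%N} -> sigma n @[n --> \oo] --> \oo.
Proof.
move=> h A [N _ NA]; exists N => // n /= Nn; apply: NA => /=.
exact: leq_trans Nn (subseq_ge h n).
Qed.

Section Reals.
Context (R : realType).

Lemma natSV_lt (e : R) : 0 < e -> exists k : nat, k.+1%:R^-1 < e.
Proof.
move=> e0; exists (Num.truncn e^-1).
by rewrite -[ltRHS]invrK ltf_pV2 ?posrE ?ltr0n ?invr_gt0// truncnS_gt.
Qed.

(** Two values with equal integer parts of their multiples by j + 1 differ by less than 1 / (j + 1),
    which gives the Cauchy property. Real convergence is thus reduced to eventual constancy of
    integer sequences, the form in which subsequences are extracted below. *)
Lemma cvg_truncn (y : nat -> R) : (forall n, 0 <= y n) ->
  (forall j : nat, exists c : nat, \forall n \near \oo, Num.truncn (j.+1%:R * y n) = c) ->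
  cvgn y.
Proof.
move=> y0 H; apply/cauchy_cvgP/cauchy_exP => e e0.
have [j je] := natSV_lt e0.
have [c [N _ Nc]] := H j.
exists (y N), N => // n /= Nn; rewrite /ball/=.
have /Nc/= cN := leqnn N; have /= cn := Nc n Nn.
have jp : 0 < j.+1%:R :> R by rewrite ltr0n.
have t k : c = Num.truncn (j.+1%:R * y k) -> c%:R <= j.+1%:R * y k < c.+1%:R.
  by move=> ->; apply: truncn_itv; rewrite mulr_ge0// ltW.
have /andP[a1 a2] := t _ (esym cN); have /andP[b1 b2] := t _ (esym cn).
apply: lt_trans je; rewrite -(ltr_pM2l jp) divff ?gt_eqF//.
rewrite -{1}(gtr0_norm jp) -normrM mulrBr ltr_norml.
rewrite -[c.+1]addn1 natrD in a2 b2.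
by apply/andP; split; lra.
Qed.

Lemma ultra_bounded_cvg (U : set_system nat) (y : nat -> R) M :
  UltraFilter U -> (forall n, `|y n| <= M) -> exists l : R, y @ U --> l.
Proof.
move=> UU yM.
have yI : (y @ U) `[- M, M]%classic.
  by apply: (@filterE nat U) => n /=; rewrite in_itv/= -ler_norml.
have [l [_ cl]] := @segment_compact R (- M) M (y @ U) _ yI.
exists l => V lV; case: (in_ultra_setVsetC (y @^-1` V) UU) => // UV.
have [_ [[n + <-] Vn]] := cl (y @` (~` (y @^-1` V))) V (filterS (@preimage_image _ _ y _) UV) lV.
by move=> /(_ Vn).
Qed.

End Reals.

(** * The pairing and sequential weak* compactness *)

Section Pairing.
Context (R : realType) (X Xs : normedModType R).
Context (pairing : {bilinear X -> Xs -> R | *%R & *%R}).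
Context (pairing_predual : is_predual pairing).

Lemma pairing_scale_bound x u M : (forall v, `|v| <= 1 -> `|pairing x v| <= M) ->
  `|pairing x u| <= M * `|u|.
Proof.
move=> H; have [->|u0] := eqVneq u 0; first by rewrite linear0r !normr0 mulr0.
have n0 : 0 < `|u| by rewrite normr_gt0.
have : `|pairing x (`|u|^-1 *: u)| <= M.
  by apply: H; rewrite normrZ normfV normr_id mulVf// gt_eqF.
by rewrite linearZr/= normrM normfV normr_id mulrC ler_pdivrMr.
Qed.

(** The [sup] of an unbounded set is a default value, so the norm formula of [is_predual] is
    informative only once boundedness is known. This comes from continuity at 0: the factor [e / 2]
    brings the unit ball into the neighbourhood of radius [e]. *)
Lemma pairing_has_sup x :
  has_sup [set `|pairing x u| | u in [set u | `|u| <= 1]].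
Proof.
have [cont _ _] := pairing_predual; split.
  by exists 0, 0 => /=; rewrite ?normr0// linear0r normr0.
have /cvgrPdist_lt /(_ _ ltr01) := cont x 0.
rewrite linear0r => /nbhs_norm0P[e /= e0 He].
exists (2 / e) => _ [u /= u1 <-].
have e2 : 0 < e / 2 by rewrite divr_gt0.
have : `|pairing x ((e / 2) *: u)| < 1.
  rewrite -[ltLHS]normrN -[- _]add0r; apply: He => /=.
  rewrite normrZ gtr0_norm//.
  by apply: le_lt_trans (_ : e / 2 * 1 < e); [rewrite ler_pM2l|lra].
rewrite linearZr/= normrM gtr0_norm// mulrC -ltr_pdivlMr// => /ltW.
by rewrite div1r invf_div.
Qed.

Lemma pairing_le x u : `|pairing x u| <= `|x| * `|u|.
Proof.
apply: pairing_scale_bound => v v1.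
have [_ _ ->] := pairing_predual.
by apply: sup_upper_bound; [exact: pairing_has_sup|exists v].
Qed.

Lemma predual_norm_le x M : (forall u, `|u| <= 1 -> `|pairing x u| <= M) -> `|x| <= M.
Proof.
move=> H; have [_ _ ->] := pairing_predual.
apply: sup_le_ub; first by have [] := pairing_has_sup x.
by move=> _ [u /= u1 <-]; exact: H.
Qed.

(** The source of new points of X: weak* limits and weak* integrals are first found as bounded
    functionals on Xs and then represented here. *)
Lemma pairing_represent (L : Xs -> R) M : 0 <= M ->
  (forall a u v, L (a *: u + v) = a * L u + L v) ->
  (forall u, `|L u| <= M * `|u|) ->
  exists2 x, (forall u, pairing x u = L u) & `|x| <= M.
Proof.
move=> M0 Llin LM.
pose L' : Xs -> R^o := L.
have lin : linear L' by move=> a u v; rewrite /L' Llin.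
pose LM' := GRing.isLinear.Build _ _ _ _ L' lin.
pose phi : {linear Xs -> R^o} := HB.pack L' LM'.
have cphi : continuous phi.
  apply/linear_bounded_continuous/linear_boundedP; exists (`|M| + 1); split; first exact: num_real.
  move=> r Mr u; apply: le_trans (LM u) _; rewrite ler_wpM2r//.
  by apply: le_trans (ler_norm _) _; apply: le_trans (ltW Mr); rewrite lerDl.
have [_ /(_ phi cphi)[x xphi] _] := pairing_predual.
exists x => //; apply: predual_norm_le => u u1; rewrite xphi.
by apply: le_trans (LM u) _; rewrite ler_piMr.
Qed.

End Pairing.

Lemma separable_sequence (R : realType) (X : normedModType R) : separable X ->
  exists d_ : nat -> X, forall (x : X) (e : R), 0 < e -> exists i, `|x - d_ i| < e.
Proof.
case=> D cD dD.
have D0 x e : 0 < e -> exists2 y, D y & `|x - y| < e.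
  move=> e0; have [||y [By Dy]] := dD (ball x e).
  - by exists x; exact: ballxx.
  - exact: ball_open.
  - by exists y => //; move: By; rewrite -ball_normE.
have [y0 Dy0 _] := D0 0 1 ltr01.
have [D00|[f]] := pfcard_geP cD; first by move: Dy0; rewrite D00.
exists f => x e /(D0 x)[y Dy H].
by have [i _ fi] := @surj _ _ _ _ f y Dy; exists i; rewrite fi.
Qed.

Section WeakStar.
Context (R : realType) (X Xs : normedModType R).
Context (pairing : {bilinear X -> Xs -> R | *%R & *%R}).
Context (pairing_predual : is_predual pairing).

Lemma weak_star_cvg (x_ : nat -> X) x :
  (forall u, pairing (x_ n) u @[n --> \oo] --> pairing x u) ->
  (x_ : nat -> weak_star pairing) @ \oo --> (x : weak_star pairing).
Proof.
move=> H V [_ [[W oW <-] Wx] WV]; apply: filterS WV _.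
suff : (fun n => (pairing (x_ n) : {ptws Xs -> R})) @ \oo --> (pairing x : {ptws Xs -> R}).
  by apply; exact: open_nbhs_nbhs.
by apply/pointwise_cvgP => u; exact: H.
Qed.

(** A countable substitute for the unit ball of Xs; it computes the norm of X and hence separates
    the points of X. *)
Definition norming (u_ : nat -> Xs) := (forall i, `|u_ i| <= 1) /\
  forall (x : X) (e : R), 0 < e -> exists i, `|x| - e < pairing x (u_ i).

(** Near-optimal functionals for a dense sequence suffice: replacing [x] by a close [d_ j] changes
    both the norm and the pairing by at most the distance, and the third part of [e] pays for the
    non-optimality. *)
Lemma norming_exists : separable X -> exists u_, norming u_.
Proof.
move=> /separable_sequence[d_ dP].
have step (jk : nat * nat) : exists u : Xs, `|u| <= 1 /\ 
    `|d_ jk.1| - jk.2.+1%:R^-1 < pairing (d_ jk.1) u.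
  have k0 : 0 < jk.2.+1%:R^-1 :> R by rewrite invr_gt0.
  have := sup_adherent k0 (pairing_has_sup pairing_predual (d_ jk.1)).
  have [_ _ <-] := pairing_predual.
  case=> _ [u /= u1 <-]; case: (ger0P (pairing (d_ jk.1) u)) => s H; first by exists u.
  by exists (- u); rewrite normrN linearNr.
have [w wP] := choice step.
exists (fun i => if unpickle i is Some jk then w jk else 0); split.
  by move=> i; case: unpickle => [jk|]; [have [] := wP jk|rewrite normr0].
move=> x e e0; have e3 : 0 < e / 3 by rewrite divr_gt0.
have [j xj] := dP x _ e3.
have [k ke] := natSV_lt e3.
exists (pickle (j, k)); rewrite pickleK; have [u1 /= uj] := wP (j, k).
have := pairing_le pairing_predual (x - d_ j) (w (j, k)).
rewrite linearBl => h.
have {}h : `|pairing x (w (j, k)) - pairing (d_ j) (w (j, k))| < e / 3.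
  by apply: le_lt_trans h _; apply: le_lt_trans xj; rewrite ler_piMr.
have := lerB_dist x (d_ j).
move: h; rewrite ltr_norml => /andP[h1 h2] h3.
by move: (k.+1%:R^-1) ke uj => a ke uj; lra.
Qed.

Lemma norming_separates u_ x : norming u_ -> (forall i, pairing x (u_ i) = 0) -> x = 0.
Proof.
move=> [_ un] x0; apply/eqP; rewrite -normr_le0 leNgt; apply/negP => xp.
by have [i] := un x _ xp; rewrite subrr x0 ltxx.
Qed.

(** Banach-Alaoglu along an ultrafilter: every pairing stays in a compact interval and so converges,
    and the limits form a bounded linear functional, which is a point of X. *)
Lemma ultra_weak_star_cvg (U : set_system nat) (x_ : nat -> X) M :
  UltraFilter U -> (forall n, `|x_ n| <= M) ->
  exists2 x, `|x| <= M & forall u, pairing (x_ n) u @[n --> U] --> pairing x u.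
Proof.
move=> UU xM.
have M0 : 0 <= M by apply: le_trans (xM 0%N).
have bd u n : `|pairing (x_ n) u| <= M * `|u|.
  by apply: le_trans (pairing_le pairing_predual _ _) _; rewrite ler_wpM2r.
have /choice[L LP] : forall u, exists l : R, pairing (x_ n) u @[n --> U] --> l.
  by move=> u; exact: ultra_bounded_cvg (bd u).
have [a u v|u|x xL xM'] := pairing_represent pairing_predual (L := L) M0.
- suff c1 : pairing (x_ n) (a *: u + v) @[n --> U] --> a * L u + L v.
    exact: cvg_unique (LP _) c1.
  rewrite (_ : (fun n => _) = fun n => a * pairing (x_ n) u + pairing (x_ n) v).
    by apply: cvgD; [apply: cvgM; [exact: cvg_cst|exact: LP]|exact: LP].
  by apply/funext => n; rewrite linearDr linearZr.
- have : `|pairing (x_ n) u| @[n --> U] --> `|L u| by exact: cvg_norm.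
  by move/cvgr_to_le; apply; exact: (@filterE _ U).
- by exists x => // u; rewrite xL.
Qed.

Lemma weak_star_complete u_ (x_ : nat -> X) M : norming u_ ->
  (forall n, `|x_ n| <= M) -> (forall i, cvgn (fun n => pairing (x_ n) (u_ i))) ->
  exists2 x, `|x| <= M & forall u, pairing (x_ n) u @[n --> \oo] --> pairing x u.
Proof.
move=> nu xM cv.
have lim F x i : ProperFilter F -> \oo `<=` F ->
    (forall u, pairing (x_ n) u @[n --> F] --> pairing x u) ->
    pairing x (u_ i) = limn (fun n => pairing (x_ n) (u_ i)).
  move=> FF oF xF.
  suff : pairing (x_ n) (u_ i) @[n --> F] --> limn (fun n => pairing (x_ n) (u_ i)).
    exact: cvg_unique (xF _).
  by apply: cvg_trans (cv i); exact: cvg_app.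
have uniq (F G : set_system nat) x y : ProperFilter F -> ProperFilter G ->
    \oo `<=` F -> \oo `<=` G ->
    (forall u, pairing (x_ n) u @[n --> F] --> pairing x u) ->
    (forall u, pairing (x_ n) u @[n --> G] --> pairing y u) -> x = y.
  move=> FF FG oF oG xF yG; apply/eqP; rewrite -subr_eq0; apply/eqP.
  apply: (norming_separates nu) => i; rewrite linearBl/=.
  by rewrite (lim F x i)// (lim G y i)// subrr.
(* All limits along ultrafilters agree, since they have the same coordinates. *)
have [U [UU oU]] := @ultraFilterLemma nat \oo _.
have [x xM' xU] := ultra_weak_star_cvg UU xM.
exists x => // u; apply/cvgrPdist_lt => e e0.
apply: contrapT => nH.
(* If convergence failed, [B] would meet every tail, so some ultrafilter finer than [\oo] would
   contain it. The limit along that ultrafilter is again [x], which contradicts the definition of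
   [B]. *)
pose B := [set n | ~ (`|pairing x u - pairing (x_ n) u| < e)].
have FB : ProperFilter (within B \oo).
  apply: Build_ProperFilter => h; apply: nH.
  have {}h : \forall n \near \oo, B n -> False by [].
  by near=> n; apply: contrapT; near: n.
have [V [UV wV]] := ultraFilterLemma FB.
have [y yM' yV] := ultra_weak_star_cvg UV xM.
have oV : \oo `<=` V by move=> A oA; apply: wV; exact: (@cvg_within _ \oo).
have VB : V B by apply: wV; rewrite /within/=; apply: nearW.
have xy := uniq _ _ _ _ _ _ oU oV xU yV.
have /cvgrPdist_lt/(_ e e0) := yV u.
rewrite -xy => /(filterI VB) /filter_ex[n []]; exact.
Unshelve. all: by end_near.
Qed.

Lemma weak_star_seq_compact u_ (x_ : nat -> X) M : norming u_ ->
  (forall n, `|x_ n| <= M) ->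
  exists sigma : nat -> nat, exists x, [/\ {homo sigma : m n / (m < n)%N}, `|x| <= M &
    forall u, pairing (x_ (sigma n)) u @[n --> \oo] --> pairing x u].
Proof.
move=> nu xM.
have M0 : 0 <= M by apply: le_trans (xM 0%N).
have bd i n : `|pairing (x_ n) (u_ i)| <= M.
  apply: le_trans (pairing_le pairing_predual _ _) _.
  by rewrite -[leRHS]mulr1 ler_pM//; apply nu.
(* The shift by the bound [M] makes the coordinates nonnegative, as [cvg_truncn] requires. *)
pose y i n := pairing (x_ n) (u_ i) + M.
have y0 i n : 0 <= y i n by move: (bd i n); rewrite ler_norml /y => /andP[? _]; lra.
pose a (k : nat) n := if @unpickle (nat * nat)%type k is Some (i, j) then Num.truncn (j.+1%:R * y i n) else 0%N.
pose b (k : nat) := if @unpickle (nat * nat)%type k is Some (i, j) then Num.truncn (j.+1%:R * (M + M)) else 0%N.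
have [k n|sigma hs sP] := @diagonal_subsequence a b.
  rewrite /a /b; case: unpickle => // -[i j]; apply: le_truncn; rewrite ler_wpM2l// lerD2r.
  exact: le_trans (ler_norm _) (bd i n).
have [|i|x xM' xP] := @weak_star_complete u_ (x_ \o sigma) M nu; [by move=> n /=..| |].
  have cy : cvgn (y i \o sigma).
    apply: cvg_truncn => [n|j]; first exact: y0.
    by have [c] := sP (pickle (i, j)); rewrite /a pickleK; exists c.
  rewrite (_ : (fun _ => _) = (fun n => (y i \o sigma) n - M)); last first.
    by apply/funext => n; rewrite /y /= addrK.
  by apply: is_cvgB => //; exact: is_cvg_cst.
by exists sigma, x; split.
Qed.

End WeakStar.

Lemma limn_einf_le (R : realType) (f g : nat -> \bar R) (l : \bar R) :
  (\forall n \near \oo, f n <= g n)%E -> g @ \oo --> l -> (limn_einf f <= l)%E.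
Proof.
move=> fg gl; rewrite limn_einf_lim -(cvg_lim _ gl)//.
apply: lee_lim; [exact: is_cvg_einfs|by apply/cvg_ex; exists l|].
apply: filterS fg => n /(le_trans _); apply.
by apply: ereal_inf_lbound; exists n => /=.
Qed.

(** * Separation of convex sets in countably many coordinates *)

Section Separation.
Context (R : realType) (X Xs : normedModType R).
Context (pairing : {bilinear X -> Xs -> R | *%R & *%R}).
Context (pairing_predual : is_predual pairing).

Lemma weak_star_norm_lsc (x_ : nat -> X) x M : (forall n, `|x_ n| <= M) ->
  (forall u, pairing (x_ n) u @[n --> \oo] --> pairing x u) -> `|x| <= M.
Proof.
move=> xM cx; apply: (predual_norm_le pairing_predual) => u u1.
apply: (cvgr_to_le (cvg_norm (cx u))).
apply: nearW => n; apply: le_trans (pairing_le pairing_predual _ _) _.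
by apply: le_trans (xM n); rewrite ler_piMr.
Qed.

Context (u_ : nat -> Xs) (u_norming : norming pairing u_).

(** Sequential closedness is enough here, since bounded sequences have weak* convergent
    subsequences. *)
Definition weak_star_closed (K : set X) := forall (x_ : nat -> X) x,
  (forall n, K (x_ n)) ->
  (forall u, pairing (x_ n) u @[n --> \oo] --> pairing x u) -> K x.

Definition segment_closed (K : set X) := forall (t : R) x y,
  0 <= t <= 1 -> K x -> K y -> K (x + t *: (y - x)).

Context (K : set X) (M : R) (K_closed : weak_star_closed K).
Context (K_convex : segment_closed K) (K_bounded : forall x, K x -> `|x| <= M).
Context (K_nonempty : K !=set0).

(* First-order condition at a point k of K that minimizes the distance to gamma in
   the first n coordinates. *)
Lemma projection_exists (gamma : nat -> R) n :
  exists2 k, K k & forall y, K y ->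
    \sum_(i < n) (gamma i - pairing k (u_ i)) * (pairing y (u_ i) - pairing k (u_ i)) <= 0.
Proof.
pose q y := \sum_(i < n) (gamma i - pairing y (u_ i)) ^+ 2.
have q0 y : 0 <= q y by apply: sumr_ge0 => i _; exact: sqr_ge0.
have hinf : has_inf (q @` K).
  split; first by case: K_nonempty => k Kk; exists (q k), k.
  by exists 0 => _ [y _ <-].
have /choice[y_ yP] : forall m : nat, exists y, K y /\ q y < inf (q @` K) + m.+1%:R^-1.
  move=> m; have m0 : 0 < m.+1%:R^-1 :> R by rewrite invr_gt0 ltr0n.
  by have [_ [y Ky <-] H] := inf_adherent m0 hinf; exists y.
have [|sg [k [hs kM kP]]] := @weak_star_seq_compact _ _ _ _ pairing_predual u_ y_ M u_norming.
  by move=> m; apply: K_bounded; have [] := yP m.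
have Kk : K k by apply: K_closed kP => m; have [] := yP (sg m).
(* The function [q] involves finitely many coordinates, so it is continuous along the weak*
   convergent minimizing sequence. *)
have qk : q k <= inf (q @` K).
  have c1 : q (y_ (sg m)) @[m --> \oo] --> q k.
    apply: cvg_big => //; first by move=> *; exact: (@add_continuous R).
    move=> i _; under eq_fun do rewrite expr2; rewrite expr2.
    by apply: cvgM; apply: cvgB; [exact: cvg_cst|exact: kP|exact: cvg_cst|exact: kP].
  have c2 : inf (q @` K) + m.+1%:R^-1 @[m --> \oo] --> inf (q @` K).
    by rewrite -[X in _ --> X]addr0; apply: cvgD; [exact: cvg_cst|exact: cvg_harmonic].
  apply: ler_cvg_to c1 c2 _; apply: nearW => m.
  apply: ltW; apply: lt_le_trans (yP (sg m)).2 _; rewrite lerD2l.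
  by rewrite lef_pV2 ?posrE ?ltr0n// ler_nat ltnS; exact: subseq_ge.
exists k => // y Ky.
set B := \sum_(i < n) _; pose C := \sum_(i < n) (pairing y (u_ i) - pairing k (u_ i)) ^+ 2.
have C0 : 0 <= C by apply: sumr_ge0 => i _; exact: sqr_ge0.
have H t : 0 <= t <= 1 -> 2 * t * B <= t ^+ 2 * C.
  move=> t01; have Kt := K_convex t01 Kk Ky.
  have : q k <= q (k + t *: (y - k)).
    by apply: le_trans qk _; apply: inf_lbound; [have [] := hinf|exists (k + t *: (y - k))].
  suff -> : q (k + t *: (y - k)) = q k - 2 * t * B + t ^+ 2 * C by lra.
  rewrite /q /B /C !mulr_sumr -sumrN -!big_split/=; apply: eq_bigr => i _.
  rewrite linearDl/= linearZl/= linearBl/=; ring.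
rewrite leNgt; apply/negP => B0.
(* With this t one has t (C + 1) <= B, so 2 t B <= t^2 C would give 2 t B < t B, against B > 0. The
   added 1 covers C = 0. *)
pose t := Num.min 1 (B / (C + 1)).
have C1 : 0 < C + 1 by rewrite ltr_wpDl.
have t0 : 0 < t by rewrite lt_min ltr01 divr_gt0.
have t1 : t <= 1 by rewrite ge_min lexx.
have tB : t * (C + 1) <= B by rewrite -ler_pdivlMr// ge_min lexx orbT.
have := H t; rewrite (ltW t0) t1 => /(_ isT).
move=> h.
have p1 : 0 <= t * (B - t * (C + 1)) by rewrite mulr_ge0 ?(ltW t0)// subr_ge0.
have p2 : 0 < t * B by rewrite mulr_gt0.
have p3 : 0 < t * t by rewrite mulr_gt0.
by move: (t) (B) (C) h p1 p2 p3 => a b c; lra.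
Qed.

(** Euclidean projection in the first n coordinates plays the part of Hahn-Banach: a nonzero
    residual is a separating functional. If the residual vanishes for every n, there are points of K
    that match more and more coordinates, and a weak* limit of them matches all. *)
Lemma image_or_separate (gamma : nat -> R) :
  (exists2 k, K k & forall i, pairing k (u_ i) = gamma i) \/
  exists n (c : nat -> R) s,
    (forall y, K y -> \sum_(i < n) c i * pairing y (u_ i) <= s) /\
    s < \sum_(i < n) c i * gamma i.
Proof.
have [h|h] := pselect (exists n (c : nat -> R) s,
    (forall y, K y -> \sum_(i < n) c i * pairing y (u_ i) <= s) /\
    s < \sum_(i < n) c i * gamma i); [by right|left].
have /choice[y_ yP] : forall n, exists k, K k /\ forall i, (i < n)%N -> pairing k (u_ i) = gamma i.
  move=> n; have [k Kk kP] := projection_exists gamma n.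
  exists k; split=> // i ilt.
  pose c j := gamma j - pairing k (u_ j).
  have sq : \sum_(j < n) c j ^+ 2 <= 0.
    rewrite leNgt; apply/negP => s0; apply: h.
    exists n, c, (\sum_(j < n) c j * pairing k (u_ j)); split=> [y Ky|].
      rewrite -subr_le0 -sumrB; under eq_bigr do rewrite -mulrBr; exact: kP.
    rewrite -subr_gt0 -sumrB; under eq_bigr do rewrite -mulrBr -expr2; exact: s0.
  have : \sum_(j < n) c j ^+ 2 == 0.
    by rewrite eq_le sq sumr_ge0// => j _; exact: sqr_ge0.
  rewrite psumr_eq0; last by move=> j _; exact: sqr_ge0.
  move=> /allP/(_ (Ordinal ilt)); rewrite mem_index_enum => /(_ isT)/=.
  by rewrite sqrf_eq0 subr_eq0 => /eqP.
have [|sg [k [hs kM kP]]] := @weak_star_seq_compact _ _ _ _ pairing_predual u_ y_ M u_norming.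
  by move=> m; apply: K_bounded; have [] := yP m.
exists k; first by apply: K_closed kP => m; have [] := yP (sg m).
move=> i; suff : pairing (y_ (sg m)) (u_ i) @[m --> \oo] --> gamma i by exact: cvg_unique (kP _).
apply: cvg_near_cst; exists i.+1 => // m /= im.
have [_ ->//] := yP (sg m); exact: leq_trans im (subseq_ge hs m).
Qed.

(** Rational coefficients, given as a list, make these functionals a countable family that [pickle]
    enumerates. *)
Definition ratcomb (c : seq rat) : Xs := \sum_(i < size c) ratr (c`_i) *: u_ i.

Lemma pairing_ratcomb x c :
  pairing x (ratcomb c) = \sum_(i < size c) ratr (c`_i) * pairing x (u_ i).
Proof. by rewrite linear_sumr/=; apply: eq_bigr => i _; rewrite linearZr. Qed.

Lemma image_or_ratcomb_separates (gamma : nat -> R) :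
  (exists2 k, K k & forall i, pairing k (u_ i) = gamma i) \/
  exists (c : seq rat) (s : R), (forall y, K y -> pairing y (ratcomb c) <= s) /\
    s < \sum_(i < size c) ratr (c`_i) * gamma i.
Proof.
have [?|[n [c [s [cs sc]]]]] := image_or_separate gamma; [by left|right].
have M0 : 0 <= M by case: K_nonempty => k /K_bounded; exact: le_trans.
set G := \sum_(i < n) c i * gamma i in sc.
(* Changing each coefficient by at most [e] moves the values on K by at most e n M and the value at
   [gamma] by at most e times the sum of the [|gamma i|]. Both together stay below [e * D], half of
   the gap [G - s]. *)
pose D := n%:R * M + \sum_(i < n) `|gamma i| + 1.
have D0 : 0 < D.
  by rewrite ltr_wpDl// addr_ge0// ?mulr_ge0// sumr_ge0.
pose e := (G - s) / (2 * D).
have e0 : 0 < e by rewrite divr_gt0 ?subr_gt0// mulr_gt0.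
have /choice[r rP] : forall i, exists r : rat, c i - e < ratr r < c i + e.
  move=> i; have : c i - e < c i + e by lra.
  by move=> /rat_in_itvoo[r]; rewrite in_itv/= => ?; exists r.
have {}rP i : `|ratr (r i) - c i| <= e.
  by have /andP[? ?] := rP i; rewrite ler_norml; apply/andP; split; lra.
have bd (d : nat -> R) : `|\sum_(i < n) ratr (r i) * d i - \sum_(i < n) c i * d i|
    <= e * \sum_(i < n) `|d i|.
  rewrite -sumrB mulr_sumr; apply: le_trans (ler_norm_sum _ _ _) _.
  by apply: ler_sum => i _; rewrite -mulrBl normrM ler_wpM2r.
exists (mkseq r n), (s + e * (n%:R * M)).
have sE (d : nat -> R) : \sum_(i < size (mkseq r n)) ratr (mkseq r n)`_i * d i =
    \sum_(i < n) ratr (r i) * d i.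
  by rewrite size_mkseq; apply: eq_bigr => i _; rewrite nth_mkseq.
split=> [y Ky|].
  rewrite pairing_ratcomb (sE (fun i => pairing y (u_ i))).
  have := bd (fun i => pairing y (u_ i)); rewrite ler_norml => /andP[_ h1].
  have h2 := cs _ Ky.
  have h3 : e * \sum_(i < n) `|pairing y (u_ i)| <= e * (n%:R * M).
    rewrite ler_pM2l//.
    apply: (@le_trans _ _ (\sum_(i < n) M)); last first.
      by rewrite big_const_ord iter_addr_0 mulr_natl.
    apply: ler_sum => i _; apply: le_trans (pairing_le pairing_predual _ _) _.
    by rewrite -[leRHS]mulr1 ler_pM//; [exact: K_bounded|apply u_norming].
  by lra.
rewrite sE; have := bd gamma; rewrite ler_norml -/G => /andP[h1 _].
set T := \sum_(i < n) ratr _ * _ in h1 *.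
have : e * D < G - s.
  rewrite /e invfM mulrA -!mulrA mulVf ?gt_eqF// mulr1 ltr_pdivrMr//.
  by rewrite ltr_pMr ?subr_gt0// ltrDl.
by rewrite /D !mulrDr mulr1; lra.
Qed.

End Separation.

(** * Countable duality for the integrand *)

Section ConvexDuality.
Context (R : realType) (X Xs : normedModType R).
Context (pairing : {bilinear X -> Xs -> R | *%R & *%R}).
Context (pairing_predual : is_predual pairing).
Context (u_ : nat -> Xs) (u_norming : norming pairing u_).
Context (j : X -> \bar R) (C : R) (C0 : 0 < C).
Context (j_ge0 : forall v, (0 <= j v)%E) (j_convex : convex_efun j).
Context (j_homo : positively_homogeneous j).
Context (j_coercive : forall v, (`|v|%:E <= C%:E * j v)%E).
Context (j_lsc : forall (x_ : nat -> X) x,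
  (forall u, pairing (x_ n) u @[n --> \oo] --> pairing x u) ->
  (j x <= limn_einf (j \o x_))%E).

Lemma homogeneous0 : j 0 = 0%E.
Proof. by rewrite -(scale0r 0) j_homo// mul0e. Qed.

(** The set where j <= 1 is convex, weak* closed, and bounded by coercivity. If t < j v, a suitable
    multiple of v lies outside it and is separated from it by a rational combination; by homogeneity
    a bound on this set becomes a linear minorant of j on all of X. *)
Lemma convex_homogeneous_sup v (t : R) : (t%:E < j v)%E ->
  exists c : seq rat, (forall y, ((pairing y (ratcomb u_ c))%:E <= j y)%E) /\
    t < pairing v (ratcomb u_ c).
Proof.
move=> tj; have [t0|t0] := ltP t 0.
  exists [::]; rewrite /ratcomb big_ord0; split=> [y|]; by rewrite linear0r.
(* A strictly positive level is needed, because [v] is divided by it. *)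
have [t' [t'0 tt' t'j]] : exists t', [/\ 0 < t', t <= t' & (t'%:E < j v)%E].
  case: (j v) tj => [r||//]; last by exists (t + 1); split; [lra|lra|exact: ltry].
  by rewrite lte_fin => tr; exists ((t + r) / 2); split; rewrite ?lte_fin; lra.
pose K := [set y | (j y <= 1)%E].
have K0 : K 0 by rewrite /K/= homogeneous0.
have Kcl : weak_star_closed pairing K.
  move=> x_ x xK cx; apply: le_trans (j_lsc cx) _.
  by apply: (@limn_einf_le _ _ (cst 1%E)); [exact: nearW|exact: cvg_cst].
have Kco : segment_closed K.
  move=> s x y s01 Kx Ky.
  have -> : x + s *: (y - x) = s *: y + (1 - s) *: x.
    by rewrite scalerBr scalerBl scale1r addrCA addrC -addrA addrC.
  rewrite /K/=; apply: le_trans (j_convex _ _ s01) _.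
  have -> : (1 = s%:E * 1 + (1 - s)%:E * 1 :> \bar R)%E.
    by rewrite !mule1 -EFinD addrC subrK.
  move/andP: s01 => [s0 s1].
  by apply: leeD; apply: lee_wpmul2l; rewrite // lee_fin// subr_ge0.
have Kb x : K x -> `|x| <= C.
  move=> Kx; rewrite -lee_fin; apply: le_trans (j_coercive x) _.
  by rewrite -[leRHS]mule1; apply: lee_wpmul2l; rewrite // lee_fin ltW.
pose v' := t'^-1 *: v.
have vE : v = t' *: v' by rewrite /v' scalerA divff ?scale1r// gt_eqF.
case: (image_or_ratcomb_separates pairing_predual u_norming Kcl Kco Kb
         (ex_intro _ 0 K0) (fun i => pairing v' (u_ i))) => [[k Kk kv]|[c [s [cs sc]]]].
  have kv' : k = v'.
    apply/eqP; rewrite -subr_eq0; apply/eqP; apply: (norming_separates u_norming) => i.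
    by rewrite linearBl/= kv subrr.
  move: t'j; rewrite vE j_homo ?(ltW t'0)// -kv' ltNge -[X in (_ <= X)%E]mule1.
  by rewrite lee_wpmul2l// lee_fin ltW.
rewrite -pairing_ratcomb in sc.
have s0 : 0 <= s by have := cs _ K0; rewrite linear0l.
(* Dividing by a rational number strictly above [s] keeps the coefficients rational and makes the
   functional at most 1 on [K]. *)
have [r] := rat_in_itvoo sc; rewrite in_itv/= => /andP[sr rv].
have r0 : 0 < ratr r :> R by exact: le_lt_trans sr.
exists [seq r^-1 * q | q <- c].
have cE : ratcomb u_ [seq r^-1 * q | q <- c] = (ratr r)^-1 *: ratcomb u_ c.
  rewrite /ratcomb size_map scaler_sumr; apply: eq_bigr => i _.
  by rewrite (nth_map 0)// rmorphM/= fmorphV scalerA.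
rewrite cE; split=> [y|]; last first.
  rewrite linearZr/= vE linearZl/= mulrCA; apply: le_lt_trans tt' _.
  by rewrite ltr_pMr// mulrC ltr_pdivlMr// mul1r.
rewrite linearZr/=.
have [jy|jy] := eqVneq (j y) +oo%E; first by rewrite jy leey.
have jyf : j y \is a fin_num by rewrite ge0_fin_numE// lt_neqAle jy leey.
(* If j y = 0 then y cannot be normalized by j y, but coercivity gives y = 0. *)
have [jy0|jy0] := eqVneq (j y) 0%E.
  have : y = 0.
    by have := j_coercive y; rewrite jy0 mule0 lee_fin normr_le0 => /eqP.
  by move=> ->; rewrite linear0l mulr0 homogeneous0.
have fj0 : 0 < fine (j y) by rewrite fine_gt0// lt_neqAle eq_sym jy0 j_ge0 ltey_eq jyf.
have Ky : K ((fine (j y))^-1 *: y).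
  rewrite /K/= j_homo ?invr_ge0 ?(ltW fj0)// -{2}(fineK jyf) -EFinM.
  by rewrite mulVf ?gt_eqF.
have := cs _ Ky; rewrite linearZl/= mulrC ler_pdivrMr// => h.
rewrite -(fineK jyf) lee_fin mulrC ler_pdivrMr//; apply: le_trans h _.
by rewrite mulrC ler_wpM2l// ltW.
Qed.

End ConvexDuality.

Lemma closed_sequentially (R : realType) (V : pseudoMetricType R) (F : set V) :
  (forall (s_ : nat -> V) s, (forall n, F (s_ n)) -> s_ @ \oo --> s -> F s) -> closed F.
Proof.
move=> H s clF.
have /choice[s_ sP] : forall n : nat, exists t, F t /\ ball s n.+1%:R^-1 t.
  by move=> n; apply: clF; apply: nbhsx_ballx; rewrite invr_gt0 ltr0n.
apply: (H s_); first by move=> n; have [] := sP n.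
apply/cvg_ballP => e e0; have [k ke] := natSV_lt e0.
exists k => // n /= kn; apply: le_ball (sP n).2.
by apply: le_trans (ltW ke); rewrite lef_pV2 ?posrE ?ltr0n// ler_nat ltnS.
Qed.

Lemma open_borel (T : ptopologicalType) (G : set T) : open G -> measurable (G : set (borel T)).
Proof. by move=> oG; exact: sub_sigma_algebra. Qed.

Lemma closed_borel (T : ptopologicalType) (G : set T) : closed G -> measurable (G : set (borel T)).
Proof.
move=> cG; rewrite -(setCK G); apply: measurableC; apply: open_borel.
exact: closed_openC.
Qed.

Section Integrand.
Context (R : realType) (X Xs : normedModType R).
Context (pairing : {bilinear X -> Xs -> R | *%R & *%R}).
Context (pairing_predual : is_predual pairing).
Context (u_ : nat -> Xs) (u_norming : norming pairing u_).
Context (V : normedModType R) (S : set V) (S_closed : closed S).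
Context (J : X -> V -> \bar R) (C : R) (C0 : 0 < C).
Context (J_ge0 : forall v s, S s -> (0 <= J v s)%E).
Context (J_convex : forall s, S s -> convex_efun (J ^~ s)).
Context (J_homo : forall s, S s -> positively_homogeneous (J ^~ s)).
Context (J_coercive : forall v s, S s -> (`|v|%:E <= C%:E * J v s)%E).
Context (J_lsc : forall (v_ : nat -> X) (v : X) (s_ : nat -> V) (s : V),
  (forall n, S (s_ n)) -> S s ->
  (forall u, pairing (v_ n) u @[n --> \oo] --> pairing v u) -> s_ @ \oo --> s ->
  (J v s <= limn_einf (fun n => J (v_ n) (s_ n)))%E).

(** An index that codes no list gives the slope 0. *)
Definition slope i : Xs := ratcomb u_ (odflt [::] (unpickle i)).

Definition minorized i : set V :=
  [set s | S s /\ forall y, ((pairing y (slope i))%:E <= J y s)%E].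

(* The value 0 outside of [minorized i] is a lower bound because J is nonnegative. *)
Definition minorant i v s : R := \1_(minorized i) s * pairing v (slope i).

Lemma minorant_le i v s : S s -> ((minorant i v s)%:E <= J v s)%E.
Proof.
move=> Ss; rewrite /minorant indicE; case: (boolP (s \in _)) => [|_].
  by rewrite inE mul1r => -[_]; apply.
by rewrite mul0r J_ge0.
Qed.

Lemma integrand_sup v s : S s -> J v s = ereal_sup (range (fun i => (minorant i v s)%:E)).
Proof.
move=> Ss; apply/eqP; rewrite eq_le; apply/andP; split; last first.
  by apply: ge_ereal_sup => _ [i _ <-]; exact: minorant_le.
rewrite leNgt; apply/negP => h.
(* The empty combination contributes the value 0, so the supremum is not -oo; being below [J v s],
   it is a real number, which serves as [t]. *)
have [t tJ st] : exists2 t : R, (t%:E < J v s)%E & (ereal_sup (range (fun i => (minorant i v s)%:E)) <= t%:E)%E.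
  have s0 : (0 <= ereal_sup (range (fun i => (minorant i v s)%:E)))%E.
    apply: le_trans (ereal_sup_ubound (x := (minorant (pickle ([::] : seq rat)) v s)%:E) _).
      by rewrite /minorant /slope pickleK/= /ratcomb big_ord0 linear0r mulr0.
    by exists (pickle ([::] : seq rat)).
  case: (ereal_sup _) h s0 => [r h _|//|//]; last by rewrite ltNge leey.
  by exists r.
have [c [c1 c2]] := convex_homogeneous_sup pairing_predual u_norming (j := J ^~ s) C0
  (fun y => J_ge0 y Ss) (J_convex Ss) (J_homo Ss) (fun y => J_coercive y Ss)
  (fun x_ x cx => J_lsc (fun=> Ss) Ss cx (cvg_cst _)) tJ.
have : ((minorant (pickle c) v s)%:E <= t%:E)%E.
  by apply: le_trans st; apply: ereal_sup_ubound; exists (pickle c).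
rewrite /minorant indicE mem_set.
  by rewrite /slope pickleK/= mul1r lee_fin leNgt c2.
by split=> // y; rewrite /slope pickleK.
Qed.

(** A violation of the inequality can be scaled into the unit ball, where it has some margin 1 / (n
    + 1). For a fixed margin the points with a violation form a closed set [F n], by weak*
    compactness of the ball and joint lower semicontinuity; no projection of a Borel set occurs. *)
Lemma measurable_minorized i : measurable (minorized i : set (borel V)).
Proof.
pose F n := [set s | S s /\ exists v, `|v| <= 1 /\
  (J v s <= (pairing v (slope i) - n.+1%:R^-1)%:E)%E].
have -> : minorized i = S `\` \bigcup_n F n.
  apply/seteqP; split=> s [Ss H]; split=> //.
    move=> [n _ [_ [v [_]]]]; apply/negP; rewrite -ltNge.
    apply: lt_le_trans (H v); rewrite lte_fin ltrBlDr ltrDl.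
    by rewrite invr_gt0 ltr0n.
  move=> y; rewrite leNgt; apply/negP => h; apply: H.
  have y0 : y != 0.
    by apply/eqP => y0; move: h; rewrite y0 linear0l ltNge J_ge0.
  have yp : 0 < `|y| by rewrite normr_gt0.
  have h' : (J (`|y|^-1 *: y) s < (pairing (`|y|^-1 *: y) (slope i))%:E)%E.
    rewrite J_homo ?invr_ge0// linearZl/= EFinM lte_pmul2l//.
    by rewrite lte_fin invr_gt0.
  have Jf : J (`|y|^-1 *: y) s \is a fin_num.
    by rewrite ge0_fin_numE ?J_ge0//; apply: lt_trans h' _; exact: ltry.
  rewrite -(fineK Jf) lte_fin -subr_gt0 in h'.
  have [n nh] := natSV_lt h'.
  exists n => //; split=> //; exists (`|y|^-1 *: y); split.
    by rewrite normrZ normfV normr_id mulVf// gt_eqF.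
  by rewrite -(fineK Jf) lee_fin; move: (n.+1%:R^-1) nh => a; lra.
apply: measurableD; first exact: closed_borel.
apply: bigcup_measurable => n _; apply: closed_borel.
apply: closed_sequentially => s_ s sF cs.
have Ss : S s.
  by apply: (closed_cvg _ S_closed _ _ cs); apply: nearW => m; have [] := sF m.
have /choice[v_ vP] : forall m, exists v, `|v| <= 1 /\
    (J v (s_ m) <= (pairing v (slope i) - n.+1%:R^-1)%:E)%E.
  by move=> m; have [_] := sF m.
have [|sg [v [hs v1 cv]]] := @weak_star_seq_compact _ _ _ _ pairing_predual u_ v_ 1 u_norming.
  by move=> m; have [] := vP m.
split=> //; exists v; split=> //.
apply: le_trans (@J_lsc _ v (s_ \o sg) s _ Ss cv _) _.
- by move=> m; have [] := sF (sg m).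
- by apply: cvg_comp cs; exact: cvg_subseq.
apply: (@limn_einf_le _ _ (fun m => (pairing (v_ (sg m)) (slope i) - n.+1%:R^-1)%:E)).
  by apply: nearW => m; exact: (vP (sg m)).2.
by apply: cvg_EFin; [exact: nearW|apply: cvgB; [exact: cv|exact: cvg_cst]].
Qed.

End Integrand.

(** * The variation as a finite measure *)

Section EqIntegral.
Import HBNNSimple.

(** The integral sees a set function only through level sets of simple functions. This lets a
    genuine measure replace [variation], which is a plain set function, meaningful on measurable
    sets only. *)
Lemma eq_integral_measurable d (T : measurableType d) (R : realType)
    (m1 m2 : set T -> \bar R) (D : set T) (f : T -> \bar R) :
  (forall A, measurable A -> m1 A = m2 A) ->
  (\int[m1]_(x in D) f x = \int[m2]_(x in D) f x)%E.
Proof.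
move=> m12; rewrite /integral; congr (ereal_sup _ - ereal_sup _)%E;
  apply: eq_imagel => h _; rewrite /sintegral; apply: eq_fsbigr => x _;
  by rewrite m12//; exact: measurable_funPTI.
Qed.

End EqIntegral.

Local Notation variation := Defs.variation.

Section Variation.
Context d (T : measurableType d) (R : realType) (X : normedModType R).
Context (S : set T) (mS : measurable S) (mu : set T -> X).
Context (mu_additive : countably_additive S mu).

(** Additivity along a sequence of empty sets makes the partial sums n mu(set0) converge; their
    increments, constantly mu(set0), then tend to 0. *)
Lemma vector_measure0 : mu set0 = 0.
Proof.
have H : (fun n => \sum_(i < n) mu set0) @ \oo --> mu set0.
  have := mu_additive (F := fun=> set0); rewrite bigcup0//; apply => //.
  - by move=> _; exact: sub0set.
  - exact: trivIset_set0.
have H1 := H; rewrite -cvg_shiftS in H1.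
have {H H1} : (fun n => \sum_(i < n.+1) mu set0 - \sum_(i < n) mu set0) @ \oo --> mu set0 - mu set0.
  exact: cvgB.
rewrite subrr (_ : (fun n => _) = cst (mu set0)).
  by move=> h; apply: (norm_cvg_unique (F := cst (mu set0) @ \oo)) => //; exact: cvg_cst.
by apply/funext => n /=; rewrite big_ord_recr/= addrAC subrr add0r.
Qed.

Definition partition_sums E : set (\bar R) := [set x | exists n (A : 'I_n -> set T),
    [/\ forall i, measurable (A i), trivIset setT A,
        \bigcup_i A i = E `&` S
      & x = (\sum_(i < n) `|mu (A i)|)%:E] ].

Lemma partition_sums1 E : measurable E -> partition_sums E `|mu (E `&` S)|%:E.
Proof.
move=> mE; exists 1%N, (fun=> E `&` S); split.
- by move=> _; exact: measurableI.
- by move=> i j _ _ _; rewrite [i]ord1 [j]ord1.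
- by apply/seteqP; split=> [x []//|x ?]; exists ord0.
- by rewrite big_ord1.
Qed.

Lemma partition_sums_ge0 E x : partition_sums E x -> (0 <= x)%E.
Proof. by move=> [n [A [_ _ _ ->]]]; rewrite lee_fin sumr_ge0. Qed.

Lemma partition_sumsU E F x y : E `&` F = set0 ->
  partition_sums E x -> partition_sums F y -> partition_sums (E `|` F) (x + y)%E.
Proof.
move=> EF [n [A [mA tA UA ->]]] [m [B [mB tB UB ->]]].
pose D (k : 'I_(n + m)) := match fintype.split k with inl i => A i | inr j => B j end.
have DA i : D (lshift m i) = A i by rewrite /D (unsplitK (inl i)).
have DB i : D (rshift n i) = B i by rewrite /D (unsplitK (inr i)).
have AE i : A i `<=` E by move=> z Az; have [] : (E `&` S) z by rewrite -UA; exists i. 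
have BF i : B i `<=` F by move=> z Bz; have [] : (F `&` S) z by rewrite -UB; exists i. 
have AB i j z : A i z -> B j z -> False.
  by move=> /AE Ez /BF Fz; have : (E `&` F) z by []; rewrite EF.
exists (n + m)%N, D; split.
- by move=> k; rewrite /D; case: fintype.split.
- move=> k l _ _; case: (split_ordP k) => i ->; case: (split_ordP l) => j ->;
    rewrite ?DA ?DB => -[z [Hi Hj]].
  + by rewrite (tA i j)//; exists z.
  + by case: (AB _ _ _ Hi Hj).
  + by case: (AB _ _ _ Hj Hi).
  + by rewrite (tB i j)//; exists z.
- rewrite setIUl -UA -UB; apply/seteqP; split=> z.
    by move=> [k _]; case: (split_ordP k) => i ->; rewrite ?DA ?DB => ?; [left|right]; exists i.
  by move=> [] [i _ ?]; [exists (lshift m i)|exists (rshift n i)]; rewrite ?DA ?DB.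
- rewrite -EFinD big_split_ord/=; congr (_ + _)%:E; apply: eq_bigr => i _;
    by rewrite ?DA ?DB.
Qed.

Lemma variation_ge0 E : measurable E -> (0 <= variation S mu E)%E.
Proof.
move=> /partition_sums1 h; apply: le_trans (partition_sums_ge0 h) _.
exact: ereal_sup_ubound.
Qed.

Lemma norm_le_variation E : measurable E -> E `<=` S -> (`|mu E|%:E <= variation S mu E)%E.
Proof.
move=> mE /setIidPl ES; apply: ereal_sup_ubound.
by rewrite -{2}ES; exact: partition_sums1.
Qed.

Lemma variation_monotone E F : measurable E -> measurable F -> E `<=` F ->
  (variation S mu E <= variation S mu F)%E.
Proof.
move=> mE mF EF; apply: ge_ereal_sup => x xE.
have yD := partition_sums1 (measurableD mF mE).
have d0 : E `&` (F `\` E) = set0 by rewrite setIC setDKI.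
have := partition_sumsU d0 xE yD.
rewrite setDUK// => h.
apply: (@le_trans _ _ (x + `|mu ((F `\` E) `&` S)|%:E)%E).
  by rewrite leeDl.
exact: ereal_sup_ubound.
Qed.

Lemma variation0 : variation S mu set0 = 0%E.
Proof.
apply/eqP; rewrite eq_le variation_ge0// andbT; apply: ge_ereal_sup => _ [n [A [_ _ UA ->]]].
rewrite big1// => i _; suff -> : A i = set0 by rewrite vector_measure0 normr0.
by apply/seteqP; split=> // z Az; have : (set0 `&` S) z by [rewrite -UA; exists i]; case.
Qed.

Context (mu_finite : (variation S mu S < +oo)%E).

Lemma variation_fin_num E : measurable E -> variation S mu E \is a fin_num.
Proof.
move=> mE; rewrite ge0_fin_numE ?variation_ge0//.
have -> : variation S mu E = variation S mu (E `&` S).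
  by rewrite /variation -setIA setIid.
apply: le_lt_trans mu_finite; apply: variation_monotone => //; exact: measurableI.
Qed.

(** The two suprema are taken one after the other, each time with the other term moved across the
    inequality; this is where finiteness enters. *)
Lemma variation_superadditive E F : measurable E -> measurable F -> E `&` F = set0 ->
  (variation S mu E + variation S mu F <= variation S mu (E `|` F))%E.
Proof.
move=> mE mF EF; rewrite -leeBrDr ?variation_fin_num//; apply: ge_ereal_sup => x xE.
have xf : x \is a fin_num by case: xE => n [A [_ _ _ ->]].
rewrite leeBrDr ?variation_fin_num// addeC -leeBrDr//; apply: ge_ereal_sup => y yF.
rewrite leeBrDr// addeC; apply: ereal_sup_ubound.
exact: partition_sumsU EF xE yF.
Qed.

Lemma variation_sum_le (F : nat -> set T) n : (forall i, measurable (F i)) ->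
  trivIset setT F ->
  (\sum_(0 <= i < n) variation S mu (F i) <= variation S mu (\bigcup_(i < n) F i))%E.
Proof.
move=> mF tF; elim: n => [|n IH]; first by rewrite big_nil bigcup_mkord big_ord0 variation0.
rewrite big_nat_recr//= bigcup_mkord big_ord_recr/= -bigcup_mkord.
apply: le_trans (leeD2r _ IH) _.
apply: variation_superadditive => //; first exact: bigcup_measurable.
apply/seteqP; split=> // x [[i /= ilt Fi] Fn].
have /= := tF i n Logic.I Logic.I (ex_intro _ x (conj Fi Fn)).
by move=> iE; rewrite iE ltnn in ilt.
Qed.

(** Each piece of a partition of the union is cut along the [F k]. Countable additivity in norm
    bounds its mass by the sum of the masses of the cuts, and the two sums are exchanged. *)
Lemma variation_subadditive (F : nat -> set T) : (forall i, measurable (F i)) ->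
  trivIset setT F ->
  (variation S mu (\bigcup_i F i) <= \sum_(0 <= i <oo) variation S mu (F i))%E.
Proof.
move=> mF tF; apply: ge_ereal_sup => _ [n [A [mA tA UA ->]]].
have AS i : A i `<=` S.
  by move=> z Az; have : (\bigcup_i F i `&` S) z by [rewrite -UA; exists i]; case.
have AF i : A i = \bigcup_k (A i `&` F k).
  rewrite -setI_bigcupr; apply/esym/setIidPl => z Az.
  by have : (\bigcup_i F i `&` S) z by [rewrite -UA; exists i]; case.
have mAF i k : measurable (A i `&` F k) by exact: measurableI.
rewrite -sumEFin.
apply: (@le_trans _ _ (\sum_(i < n) \sum_(0 <= k <oo) `|mu (A i `&` F k)|%:E)%E).
  apply: lee_sum => i _ /=.
  have cA : (fun m => \sum_(k < m) mu (A i `&` F k)) @ \oo --> mu (A i).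
    rewrite {2}(AF i); apply: mu_additive => //.
      by move=> k; apply: subset_trans (@subIsetl _ _ _) _.
    by apply: trivIset_setIl.
  have cn : `|\sum_(k < m) mu (A i `&` F k)| @[m --> \oo] --> `|mu (A i)| by exact: cvg_norm.
  apply: (@le_trans _ _ (limn (fun m => `|\sum_(k < m) mu (A i `&` F k)|%:E))).
    by rewrite (cvg_lim _ (cvg_EFin _ cn))//; exact: nearW.
  apply: lee_lim.
  - by apply/cvg_ex; exists `|mu (A i)|%:E; apply: cvg_EFin; [exact: nearW|].
  - exact: is_cvg_nneseries.
  - apply: nearW => m; rewrite /= sumEFin lee_fin big_mkord; exact: ler_norm_sum.
rewrite -nneseries_sum//; apply: lee_nneseries => [k _ _|k _]; first exact: sume_ge0.
rewrite sumEFin; apply: ereal_sup_ubound; exists n, (fun i => A i `&` F k); split=> //.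
- exact: trivIset_setIr.
- rewrite -setI_bigcupl UA; apply/seteqP; split=> z [].
    by move=> [_ Sz] Fz.
  by move=> Fz Sz; split=> //; split=> //; exists k.
Qed.

(** A set without any measurable partition has variation -oo, the supremum of the empty set; the
    value 0 restores the nonnegativity that a measure has on all sets. *)
Let v (E : set T) : \bar R := if pselect (measurable E) then variation S mu E else 0%E.

Let vE E : measurable E -> v E = variation S mu E.
Proof. by rewrite /v; case: pselect. Qed.

Let v0 : v set0 = 0%E.
Proof. by rewrite vE// variation0. Qed.

Let v_ge0 E : (0 <= v E)%E.
Proof. by rewrite /v; case: pselect => // ?; exact: variation_ge0. Qed.

Let v_sigma_additive : semi_sigma_additive v.
Proof.
move=> F mF tF mUF.
suff -> : v (\bigcup_i F i) = (\sum_(0 <= i <oo) v (F i))%E by exact: is_cvg_nneseries.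
rewrite vE//; under eq_eseriesr do rewrite vE//.
apply/eqP; rewrite eq_le variation_subadditive//=.
apply: lime_le; first by apply: is_cvg_nneseries => i _ _; exact: variation_ge0.
apply: nearW => n; apply: le_trans (variation_sum_le n mF tF) _.
by apply: variation_monotone => //; [exact: bigcup_measurable|move=> x [i _ Fi]; exists i].
Qed.

HB.instance Definition _ := isMeasure.Build d T R v v0 v_ge0 v_sigma_additive.

Let v_fin : fin_num_fun v.
Proof. by move=> E mE; rewrite vE//; exact: variation_fin_num. Qed.

HB.instance Definition _ := Measure_isFinite.Build d T R v v_fin.

Lemma variation_measure : exists m : {finite_measure set T -> \bar R},
  forall E, measurable E -> m E = variation S mu E.
Proof. by exists v. Qed.

End Variation.

(** * Bochner integrals tested against the predual *)

Section Bochner.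
Context d (T : measurableType d) (R : realType) (X Xs : normedModType R).
Context (pairing : {bilinear X -> Xs -> R | *%R & *%R}).
Context (pairing_predual : is_predual pairing).
Context (m : {finite_measure set T -> \bar R}).
Implicit Types (g h : T -> X) (E : set T).

Lemma simple_preimage h B : simple_function h -> measurable (h @^-1` B).
Proof.
move=> [fh mh].
have -> : h @^-1` B = \bigcup_(x in range h `&` B) h @^-1` [set x].
  apply/seteqP; split=> t; first by move=> Bt; exists (h t) => //; split=> //; exists t.
  by move=> [x [_ Bx] /= ->].
by apply: fin_bigcup_measurable => //; exact: finite_setIl.
Qed.

Lemma simple_comp_measurable h (phi : X -> R) E : simple_function h -> measurable_fun E (phi \o h).
Proof.
move=> sh; apply: (@measurable_funS _ _ _ _ setT) => // _ Y mY.
by rewrite setTI comp_preimage; exact: simple_preimage.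
Qed.

Lemma simple_comp_bounded h (phi : X -> R) : simple_function h -> exists M, forall t, `|phi (h t)| <= M.
Proof.
move=> [fh _]; exists (\sum_(x <- fset_set (range h)) `|phi x|) => t.
rewrite (bigD1_seq (h t)) ?fset_uniq//=; last by rewrite in_fset_set//; apply: mem_set; exists t.
by rewrite lerDl sumr_ge0.
Qed.

Lemma bounded_integrable (f : T -> R) E M : measurable E -> measurable_fun E f ->
  (forall t, E t -> `|f t| <= M) -> m.-integrable E (EFin \o f).
Proof.
move=> mE mf fM; apply: (@le_integrable _ _ _ _ _ mE _ (cst M%:E)).
- exact/measurable_EFinP.
- by move=> t Et /=; rewrite lee_fin (le_trans (fM t Et))// ler_norm.
- exact: finite_measure_integrable_cst.
Qed.

Lemma simple_comp_integrable h (phi : X -> R) E : measurable E -> simple_function h ->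
  m.-integrable E (EFin \o (phi \o h)).
Proof.
move=> mE sh; have [M hM] := simple_comp_bounded phi sh.
by apply: (bounded_integrable mE) => [|t _]; [exact: simple_comp_measurable|exact: hM].
Qed.

Lemma pairing_simple_integral E h u : measurable E -> simple_function h ->
  (pairing (simple_integral m E h) u)%:E = (\int[m]_(t in E) (pairing (h t) u)%:E)%E.
Proof.
move=> mE sh; have [fh mh] := sh.
rewrite /simple_integral fsbig_finite//= linear_sumlz/=.
transitivity (\int[m]_(t in E) \sum_(x <- fset_set (range h))
   ((pairing x u)%:E * (\1_(h @^-1` [set x]) t)%:E))%E; last first.
  apply: eq_integral => t _; rewrite (bigD1_seq (h t)) ?fset_uniq//=; last first.
    by rewrite in_fset_set//; apply: mem_set; exists t.
  rewrite indicE mem_set//= mule1 big1 ?adde0// => x xt.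
  by rewrite indicE memNset ?mule0//= => tx; rewrite tx eqxx in xt.
have iI x : m.-integrable E (fun t => (\1_(h @^-1` [set x]) t)%:E).
  apply: (bounded_integrable (M := 1) mE); first exact: measurable_indic.
  by move=> t _; rewrite ger0_norm// indicE; case: (_ \in _).
rewrite integral_sum//; last by move=> x; exact: integrableZl.
rewrite -sumEFin; apply: eq_bigr => x _.
rewrite integralZl// integral_indic// linearZl/= mulrC EFinM fineK 1?setIC//.
by apply: fin_num_measure; exact: measurableI.
Qed.

Lemma strongly_measurable_comp E g (phi : X -> R) : continuous phi ->
  strongly_measurable E g -> measurable_fun E (phi \o g).
Proof.
move=> cphi [h sh hg]; apply: (@measurable_fun_cvg _ _ _ E (fun n => phi \o h n)).
  by move=> n; exact: simple_comp_measurable.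
by move=> t Et; apply: continuous_cvg; [exact: cphi|exact: hg].
Qed.

Lemma pairing_l_continuous u : continuous (pairing ^~ u : X -> R).
Proof.
move=> x; apply/cvgrPdist_lt => e e0.
have r0 : 0 < e / (`|u| + 1) by rewrite divr_gt0// ltr_wpDl.
have /cvgrPdist_lt/(_ _ r0) : y @[y --> x] --> x by exact: cvg_id.
apply: filterS => y xy; rewrite -linearBl/=.
apply: le_lt_trans (pairing_le pairing_predual _ _) _.
move: xy; rewrite ltr_pdivlMr; last by rewrite ltr_wpDl.
by apply: le_lt_trans; rewrite ler_wpM2l// lerDl.
Qed.

(** The two functions are not composed with subtraction on a product. Instead the domain is cut
    along the finitely many values of [h], and simple functions have measurable preimages of
    arbitrary sets. *)
Lemma strongly_measurableB E g h : strongly_measurable E g -> simple_function h ->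
  measurable_fun E (fun t => `|g t - h t|).
Proof.
move=> [k sk kg] sh.
apply: (@measurable_fun_cvg _ _ _ E (fun n t => `|k n t - h t|)); last first.
  by move=> t Et; apply: cvg_norm; apply: cvgB; [exact: kg|exact: cvg_cst].
move=> n; apply: (@measurable_funS _ _ _ _ setT) => // _ Y mY; rewrite setTI.
have -> : (fun t => `|k n t - h t|) @^-1` Y =
    \bigcup_(x in range h) (h @^-1` [set x] `&` (k n) @^-1` [set y | Y `|y - x|]).
  apply/seteqP; split=> t /=; first by move=> Yt; exists (h t) => //; exists t.
  by move=> [x _ [/= -> ]].
apply: fin_bigcup_measurable; first by case: sh.
by move=> x _; apply: measurableI; exact: simple_preimage.
Qed.

Lemma pairing_integrable E g u : measurable E -> strongly_measurable E g ->
  (\int[m]_(t in E) `|g t|%:E < +oo)%E ->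
  m.-integrable E (fun t => (pairing (g t) u)%:E).
Proof.
move=> mE sg ig.
have mp : measurable_fun E (fun t => pairing (g t) u).
  by apply: (strongly_measurable_comp (phi := pairing ^~ u)) => //; exact: pairing_l_continuous.
have mn : measurable_fun E (fun t => `|g t|).
  by apply: (strongly_measurable_comp (phi := Num.norm)) => //; exact: norm_continuous.
apply: (@le_integrable _ _ _ _ _ mE _ (fun t => `|u|%:E * `|g t|%:E)%E).
- exact/measurable_EFinP.
- move=> t Et /=; rewrite lee_fin [X in _ <= X]ger0_norm ?mulr_ge0// mulrC.
  exact: pairing_le.
- apply: integrableZl => //; apply/integrableP; split; first exact/measurable_EFinP.
  by under eq_integral do rewrite /= normr_id.
Qed.

(** The estimate behind both directions: it identifies the pairings of a Bochner integral, and it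
    shows that simple integrals converge to a given vector whose pairings are known. *)
Lemma pairing_integral_le E g h u : measurable E -> strongly_measurable E g ->
  simple_function h ->
  m.-integrable E (fun t => (pairing (g t) u)%:E) ->
  (`|\int[m]_(t in E) (pairing (g t) u)%:E - (pairing (simple_integral m E h) u)%:E| <=
    `|u|%:E * \int[m]_(t in E) `|g t - h t|%:E)%E.
Proof.
move=> mE sg sh ig.
rewrite pairing_simple_integral//.
have ih : m.-integrable E (fun t => (pairing (h t) u)%:E).
  exact: (simple_comp_integrable (pairing ^~ u)).
have mB := strongly_measurableB sg sh.
rewrite -integralB//; have mB' : measurable_fun E (fun t => (pairing (g t) u)%:E - (pairing (h t) u)%:E)%E.
  by apply: emeasurable_funB; [case/integrableP: ig|case/integrableP: ih].
apply: le_trans (le_abse_integral _ mE mB') _.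
rewrite -ge0_integralZl//; last exact/measurable_EFinP.
apply: ge0_le_integral => //.
- exact/measurableT_comp.
- by apply: emeasurable_funM; [exact: measurable_cst|exact/measurable_EFinP].
- move=> t Et; rewrite -EFinB -EFinM lee_fin -linearBl/= mulrC.
  exact: pairing_le.
Qed.

Lemma bochner_integral_pairing E g x u : measurable E -> strongly_measurable E g ->
  (\int[m]_(t in E) `|g t|%:E < +oo)%E -> is_bochner_integral m E g x ->
  (pairing x u)%:E = (\int[m]_(t in E) (pairing (g t) u)%:E)%E.
Proof.
move=> mE sg fg [h [sh h0 hx]].
have ig := pairing_integrable u mE sg fg.
have If : (\int[m]_(t in E) (pairing (g t) u)%:E)%E \is a fin_num by exact: integrable_fin_num.
set I := (\int[m]_(t in E) _)%E in If *.
rewrite -(fineK If); congr EFin.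
have c1 : pairing (simple_integral m E (h n)) u @[n --> \oo] --> pairing x u.
  have cu : continuous (pairing ^~ u : X -> R) by exact: pairing_l_continuous.
  by have /(_ _) := continuous_cvg _ (cu x) hx; apply.
have c2 : pairing (simple_integral m E (h n)) u @[n --> \oo] --> fine I.
  apply/cvgrPdist_le => e e0.
  have e1 : 0 < e / (`|u| + 1) by rewrite divr_gt0// ltr_wpDl.
  have /fine_cvgP[fin /cvgrPdist_le/(_ _ e1) cc] := h0.
  near=> n.
  rewrite -lee_fin -abse_EFin EFinB (fineK If).
  apply: le_trans (pairing_integral_le mE sg (sh n) ig) _.
  have fn : (\int[m]_(t in E) `|g t - h n t|%:E)%E \is a fin_num by near: n.
  have : `|0 - fine (\int[m]_(t in E) `|g t - h n t|%:E)%E| <= e / (`|u| + 1) by near: n.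
  rewrite sub0r normrN ger0_norm; last by apply: fine_ge0; exact: integral_ge0.
  move=> le; rewrite -(fineK fn) -EFinM lee_fin.
  apply: le_trans (ler_wpM2l (normr_ge0 _) le) _.
  by rewrite mulrCA ler_piMr ?(ltW e0)// ler_pdivrMr ?mul1r ?lerDl// ltr_wpDl.
exact: cvg_unique c1 c2.
Unshelve. all: by end_near.
Qed.

End Bochner.

(** * The Radon-Nikodym property of a separable dual *)

Lemma measurable_fun_ereal_sup_range d (T : measurableType d) (R : realType)
    (D : set T) (f : (T -> \bar R)^nat) : (forall n, measurable_fun D (f n)) ->
  measurable_fun D (fun x => ereal_sup (range (f ^~ x))).
Proof.
move=> mf; rewrite (_ : (fun _ => _) = (fun x => esups (f ^~ x) 0)).
  exact: measurable_fun_esups.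
apply/funext => x; rewrite /esups/=; congr ereal_sup.
by apply/seteqP; split=> _ [n _ <-]; exists n.
Qed.

Lemma measure_bigcup0 d (T : measurableType d) (R : realType)
    (m : {measure set T -> \bar R}) (B : nat -> set T) :
  (forall n, measurable (B n)) -> (forall n, m (B n) = 0%E) -> m (\bigcup_n B n) = 0%E.
Proof.
move=> mB B0; apply: measure_negligible; first exact: bigcup_measurable.
by apply: negligible_bigcup => n; exists (B n); split.
Qed.

Lemma strict_le_ae d (T : measurableType d) (R : realType)
    (m : {finite_measure set T -> \bar R}) (F : T -> R) (h : R) :
  m.-integrable setT (EFin \o F) ->
  (forall E, measurable E -> (\int[m]_(t in E) (F t)%:E <= h%:E * m E)%E) ->
  measurable [set t | h < F t] /\ m [set t | h < F t] = 0%E.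
Proof.
move=> iF Fh.
have mF : measurable_fun setT F by apply/measurable_EFinP; case/integrableP: iF.
pose B n := [set t | h + n.+1%:R^-1 <= F t].
have mB n : measurable (B n).
  by rewrite -[B n]setTI; apply: measurable_fun_le => //; exact: measurable_cst.
have BE : [set t | h < F t] = \bigcup_n B n.
  apply/seteqP; split=> t.
    move=> /=; rewrite -subr_gt0 => /natSV_lt[n /ltW nh]; exists n => //=.
    by rewrite /B/= -lerBrDl.
  by move=> [n _]; apply: lt_le_trans; rewrite ltrDl invr_gt0 ltr0n.
have B0 n : m (B n) = 0%E.
  have mBf : m (B n) \is a fin_num by exact: fin_num_measure.
  have n0 : 0 < n.+1%:R^-1 :> R by rewrite invr_gt0 ltr0n.
  have : ((h + n.+1%:R^-1)%:E * m (B n) <= h%:E * m (B n))%E.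
    apply: le_trans (Fh _ (mB n)); rewrite -integral_cst//.
    apply: le_integral => //.
    - exact: finite_measure_integrable_cst.
    - exact: integrableS iF.
    - by move=> t /set_mem Bt; rewrite lee_fin.
  rewrite -(fineK mBf) -!EFinM lee_fin mulrDl gerDl pmulr_rle0// => le0.
  congr EFin; apply/eqP; rewrite eq_le le0/=.
  by rewrite -lee_fin fineK.
rewrite BE; split; first exact: bigcup_measurable.
exact: measure_bigcup0.
Qed.

Section DenseApproximation.
Context d (T : measurableType d) (R : realType) (X : normedModType R).

(** [h n t] is the best approximation of [g t] met so far among 0 and the first n points of a dense
    sequence. Only distances to fixed points have to be measurable, and starting from 0 yields the
    bound by the norm of g t that dominated convergence will use. *)
Lemma simple_approximation (g : T -> X) : separable X ->
  (forall x, measurable_fun setT (fun t => `|g t - x|)) ->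
  exists h : nat -> T -> X, [/\ forall n, simple_function (h n),
    forall n t, `|g t - h n t| <= `|g t| & forall t, h n t @[n --> \oo] --> g t].
Proof.
move=> /separable_sequence[d_ dP] mg.
pose h := fix h n t := if n is n'.+1
  then if `|g t - d_ n'| < `|g t - h n' t| then d_ n' else h n' t else 0 : X.
have hS n t : `|g t - h n.+1 t| <= `|g t - h n t|.
  by rewrite /=; case: ltP => // /ltW.
have hd n t : `|g t - h n.+1 t| <= `|g t - d_ n|.
  by rewrite /=; case: ltP.
have sh n : simple_function (h n).
  elim: n => [|n [fh mh]].
    split; first by apply: (@sub_finite_set _ _ [set 0]) => // _ [t _ <-].
    move=> x; have [->|x0] := eqVneq x 0.
      by rewrite (_ : _ @^-1` _ = setT)//; apply/seteqP; split.
    rewrite (_ : _ @^-1` _ = set0)//; apply/seteqP; split=> // t /= e.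
    by rewrite e eqxx in x0.
  have mlt : measurable [set t | `|g t - d_ n| < `|g t - h n t|].
    have -> : [set t | `|g t - d_ n| < `|g t - h n t|] = \bigcup_(x in range (h n))
        (h n @^-1` [set x] `&` [set t | `|g t - d_ n| < `|g t - x|]).
      apply/seteqP; split=> t /=; first by move=> ?; exists (h n t) => //; exists t.
      by move=> [x _ [/= ->]].
    apply: fin_bigcup_measurable => // x _; apply: measurableI => //.
    rewrite (_ : [set t | _] = ~` (setT `&` [set t | `|g t - x| <= `|g t - d_ n|])).
      by apply: measurableC; apply: measurable_fun_le.
    by rewrite setTI; apply/seteqP; split=> t /=; rewrite ltNge => /negP.
  split.
    apply: (@sub_finite_set _ _ (range (h n) `|` [set d_ n])).
      by move=> _ [t _ <-] /=; case: ltP => _; [right|left; exists t].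
    by rewrite finite_setU; split.
  move=> x.
  have -> : h n.+1 @^-1` [set x] =
     ([set t | `|g t - d_ n| < `|g t - h n t|] `&` [set t | d_ n = x]) `|`
     (~` [set t | `|g t - d_ n| < `|g t - h n t|] `&` h n @^-1` [set x]).
    apply/seteqP; split=> t /=.
      by case: ltP => le e; [left|right]; split=> //; apply/negP; rewrite -leNgt.
    by case: ltP => le [] [].
  apply: measurableU; apply: measurableI => //; last exact: measurableC.
  have [e|e] := pselect (d_ n = x).
    by rewrite (_ : [set _ | _] = setT)//; apply/seteqP; split.
  by rewrite (_ : [set _ | _] = set0)//; apply/seteqP; split.
exists h; split=> //.
  by move=> n t; elim: n => [|n IH]; [rewrite /= subr0|exact: le_trans (hS n t) IH].
move=> t; apply/cvgrPdist_lt => e e0.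
have [i gi] := dP (g t) e e0.
exists i.+1 => // n /=; elim: n => // n IH; rewrite leq_eqVlt => /predU1P[[<-]|].
  exact: le_lt_trans (hd i t) gi.
by rewrite ltnS => /IH; apply: le_lt_trans.
Qed.

End DenseApproximation.

Section RadonNikodymProperty.
Context d (T : measurableType d) (R : realType) (X Xs : normedModType R).
Context (pairing : {bilinear X -> Xs -> R | *%R & *%R}).
Context (pairing_predual : is_predual pairing) (X_separable : separable X).
Context (u_ : nat -> Xs) (u_norming : norming pairing u_).
Context (S : set T) (mS : measurable S) (nu : set T -> X).
Context (nu_vm : vector_measures S nu).
Context (m : {finite_measure set T -> \bar R}).
Context (mE : forall E, measurable E -> m E = variation S nu E).

Let nu_add : countably_additive S nu. Proof. by case: nu_vm. Qed.

Lemma pairing_vector_measure_le E u : measurable E ->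
  `|pairing (nu (E `&` S)) u| <= `|u| * fine (m E).
Proof.
move=> mEE; apply: le_trans (pairing_le pairing_predual _ _) _.
rewrite mulrC ler_wpM2l// -lee_fin fineK ?fin_num_measure//.
apply: le_trans (norm_le_variation mS nu _ _) _; [exact: measurableI|exact: subIsetr|].
by rewrite mE//; apply: (variation_monotone mS nu) => //; exact: measurableI.
Qed.

(** The intersection with [S] extends the scalar measure to the ambient space, on which charges are
    defined. *)
Let lam u (E : set T) : \bar R := (pairing (nu (E `&` S)) u)%:E.

Let lam0 u : lam u set0 = 0%E.
Proof. by rewrite /lam set0I (vector_measure0 nu_add) linear0l. Qed.

Let lam_fin u E : measurable E -> lam u E \is a fin_num.
Proof. by []. Qed.

Let lam_sigma u : semi_sigma_additive (lam u).
Proof.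
move=> F mF tF mUF.
have cF : (fun n => \sum_(i < n) nu (F i `&` S)) @ \oo --> nu (\bigcup_i F i `&` S).
  rewrite setI_bigcupl; apply: nu_add.
  - by move=> i; exact: measurableI.
  - by move=> i; exact: subIsetr.
  - exact: trivIset_setIr.
have cu : continuous (pairing ^~ u : X -> R) by exact: pairing_l_continuous.
rewrite (_ : (fun n => _) = EFin \o (fun n => pairing (\sum_(i < n) nu (F i `&` S)) u)).
  apply: cvg_EFin; first exact: nearW.
  by have /(_ _) := continuous_cvg _ (cu _) cF; apply.
by apply/funext => n /=; rewrite /lam sumEFin big_mkord linear_sumlz.
Qed.

HB.instance Definition _ u :=
  isCharge.Build d T R (lam u) (lam0 u) (@lam_fin u) (@lam_sigma u).

Let lam_dom u : lam u `<< m.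
Proof.
move=> N nN A mA AN; have mA0 : m A = 0%E by exact: nN.
have := pairing_vector_measure_le u mA; rewrite mA0/= mulr0 normr_le0 => /eqP.
by rewrite /lam => ->.
Qed.

Let gam u (t : T) : R := fine (Radon_Nikodym (lam u) m t).

Let gamE u : EFin \o gam u = Radon_Nikodym (lam u) m.
Proof. by apply/funext => t /=; rewrite fineK//; apply: Radon_Nikodym_fin_num; exact: lam_dom. Qed.

Let gam_int u : m.-integrable setT (EFin \o gam u).
Proof. by rewrite gamE; apply: Radon_Nikodym_integrable; exact: lam_dom. Qed.

Let gam_integral u E : measurable E -> (\int[m]_(t in E) (gam u t)%:E)%E = lam u E.
Proof.
move=> mEE; have := Radon_Nikodym_integral (lam_dom u) mEE.
by move=> ->; apply: eq_integral => t _; rewrite -gamE.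
Qed.

Let comb (c : seq rat) t := \sum_(i < size c) ratr c`_i * gam (u_ i) t.

Let comb_int c : m.-integrable setT (EFin \o comb c).
Proof.
rewrite (_ : _ \o _ = fun t => (\sum_(i < size c) (ratr c`_i)%:E * (gam (u_ i) t)%:E)%E).
  by apply: integrable_sum => // i _; apply: integrableZl => //; exact: gam_int.
by apply/funext => t /=; rewrite /comb -sumEFin.
Qed.

Let comb_integral c E : measurable E ->
  (\int[m]_(t in E) (comb c t)%:E)%E = lam (ratcomb u_ c) E.
Proof.
move=> mEE.
transitivity (\int[m]_(t in E) \sum_(i < size c) (ratr c`_i)%:E * (gam (u_ i) t)%:E)%E.
  by apply: eq_integral => t _; rewrite /comb -sumEFin.
have gi u : m.-integrable E (EFin \o gam u) by apply: integrableS (gam_int u).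
rewrite integral_sum//; last by move=> i; apply: integrableZl => //; exact: gi.
rewrite /lam pairing_ratcomb -sumEFin; apply: eq_bigr => i _.
by rewrite integralZl//; [rewrite gam_integral//|exact: gi].
Qed.

Let ball1 := [set y : X | `|y| <= 1].

(** The mass of nu on E has norm at most m(E), so a functional bounded by s on the unit ball
    integrates to at most s m(E) on each E; hence its density is at most s almost everywhere. *)
Let comb_le c s : (forall y, ball1 y -> pairing y (ratcomb u_ c) <= s) ->
  measurable [set t | s < comb c t] /\ m [set t | s < comb c t] = 0%E.
Proof.
move=> cs; apply: strict_le_ae => // E mEE; rewrite comb_integral// /lam.
have mf : m E \is a fin_num by exact: fin_num_measure.
rewrite -(fineK mf) -EFinM lee_fin.
have nE : `|nu (E `&` S)| <= fine (m E).
  rewrite -lee_fin fineK// mE//.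
  apply: le_trans (norm_le_variation mS nu _ _) _; [exact: measurableI|exact: subIsetr|].
  by apply: (variation_monotone mS) => //; exact: measurableI.
have s0 : 0 <= s.
  by have := cs 0; rewrite linear0l; apply; rewrite /ball1/= normr0.
apply: le_trans (ler_wpM2l s0 nE).
have [->|n0] := eqVneq (nu (E `&` S)) 0; first by rewrite linear0l normr0 mulr0.
have np : 0 < `|nu (E `&` S)| by rewrite normr_gt0.
have := cs (`|nu (E `&` S)|^-1 *: nu (E `&` S)).
rewrite linearZl/= mulrC ler_pdivrMr//; apply.
by rewrite /ball1/= normrZ normfV normr_id mulVf// gt_eqF.
Qed.

(** Separation produces an arbitrary real bound. Taking the least bound for each [c] leaves one null
    set per [c], hence a countable union [bad]. *)
Let supc c : R := sup [set pairing y (ratcomb u_ c) | y in ball1].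

Let supcP c y : ball1 y -> pairing y (ratcomb u_ c) <= supc c.
Proof.
move=> by1; apply: sup_upper_bound; last by exists y.
split; first by exists (pairing y (ratcomb u_ c)), y.
exists `|ratcomb u_ c| => _ [z z1 <-]; apply: le_trans (ler_norm _) _.
by apply: le_trans (pairing_le pairing_predual _ _) _; rewrite ler_piMl.
Qed.

Let bad : set T := \bigcup_(k : nat) [set t |
  supc (odflt [::] (unpickle k)) < comb (odflt [::] (unpickle k)) t].

Let mbad : measurable bad.
Proof. by apply: bigcup_measurable => k _; have [] := comb_le (@supcP (odflt [::] (unpickle k))). Qed.

Let bad0 : m bad = 0%E.
Proof.
by apply: measure_bigcup0 => k; have [] := comb_le (@supcP (odflt [::] (unpickle k))).
Qed.

Lemma density_coordinates : exists g : T -> X, [/\ forall t, `|g t| <= 1,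
  forall i, measurable_fun setT (fun t => pairing (g t) (u_ i)) &
  forall i E, measurable E ->
    (\int[m]_(t in E) (pairing (g t) (u_ i))%:E)%E = (pairing (nu (E `&` S)) (u_ i))%:E].
Proof.
have /choice[g gP] : forall t, exists x, `|x| <= 1 /\
    ((bad t -> x = 0) /\ (~ bad t -> forall i, pairing x (u_ i) = gam (u_ i) t)).
  move=> t; have [bt|bt] := pselect (bad t); first by exists 0; rewrite normr0.
  have cl : weak_star_closed pairing ball1.
    by move=> x_ x xb cx; apply: (weak_star_norm_lsc pairing_predual) cx.
  have co : segment_closed ball1.
    move=> s x y /andP[s0 s1] x1 y1; rewrite /ball1/=.
    have -> : x + s *: (y - x) = s *: y + (1 - s) *: x.
      by rewrite scalerBr scalerBl scale1r addrCA addrC -addrA addrC.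
    apply: le_trans (ler_normD _ _) _; rewrite !normrZ ger0_norm// ger0_norm ?subr_ge0//.
    apply: (@le_trans _ _ (s * 1 + (1 - s) * 1)); last by lra.
    by rewrite lerD// ler_wpM2l// subr_ge0.
  have b0 : ball1 0 by rewrite /ball1/= normr0.
  case: (image_or_ratcomb_separates pairing_predual u_norming cl co (M := 1) (fun _ => id)
      (ex_intro _ 0 b0) (fun i => gam (u_ i) t)) => [[k k1 kg]|[c [s [cs sc]]]].
    by exists k; split=> //; split.
  case: bt; exists (pickle c) => //; rewrite /mkset pickleK /=.
  apply: le_lt_trans sc; apply: ge_sup; first by exists (pairing 0 (ratcomb u_ c)), 0.
  by move=> _ [y y1 <-]; exact: cs.
have gE i : (fun t => pairing (g t) (u_ i)) = (fun t => gam (u_ i) t * \1_(~` bad) t).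
  apply/funext => t; have [_ [b1 b2]] := gP t; rewrite indicE.
  have [bt|bt] := pselect (bad t); first by rewrite b1// memNset ?mulr0 ?linear0l//=; exact.
  by rewrite mem_set// mulr1 b2.
have mgam u : measurable_fun setT (gam u).
  by apply/measurable_EFinP; case/integrableP: (gam_int u).
have mg i : measurable_fun setT (fun t => pairing (g t) (u_ i)).
  rewrite gE; apply: measurable_funM => //; apply: measurable_indic; exact: measurableC.
exists g; split=> //; first by move=> t; have [] := gP t.
move=> i E mEE; rewrite -[RHS]/(lam (u_ i) E) -gam_integral//.
apply: ae_eq_integral => //.
- exact/measurable_EFinP/measurable_funTS.
- exact/measurable_EFinP/measurable_funTS.
- exists bad; split=> // t /= h; apply: contrapT => bt; apply: h => _.
  by have [_ [_ ->]] := gP t.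
Qed.

(** The coordinates of [g] are measurable, and the distance to a fixed point is a countable supremum
    of coordinates. By separability [g] is then a limit of simple functions, and the norming
    sequence turns the scalar identities into a Bochner integral. *)
Lemma density_exists : exists g, is_density S nu g.
Proof.
have [g [g1 mg gI]] := density_coordinates.
have mgd x : measurable_fun setT (fun t => `|g t - x|).
  have -> : (fun t => `|g t - x|) = fine \o (fun t => ereal_sup (range (fun i => (pairing (g t - x) (u_ i))%:E))).
    apply/funext => t /=; suff -> : ereal_sup (range (fun i => (pairing (g t - x) (u_ i))%:E)) = `|g t - x|%:E by [].
    apply/eqP; rewrite eq_le; apply/andP; split.
      apply: ge_ereal_sup => _ [i _ <-]; rewrite lee_fin.
      apply: le_trans (ler_norm _) _; apply: le_trans (pairing_le pairing_predual _ _) _.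
      by rewrite ler_piMr//; apply u_norming.
    apply/lee_addgt0Pr => e e0; have [i] := (u_norming.2) (g t - x) e e0.
    rewrite ltrBlDr => /ltW le; apply: (@le_trans _ _ ((pairing (g t - x) (u_ i))%:E + e%:E)%E).
      by rewrite -EFinD lee_fin.
    by rewrite leeD2r//; apply: ereal_sup_ubound; exists i.
  apply: measurableT_comp => //; apply: measurable_fun_ereal_sup_range => i.
  apply/measurable_EFinP; under eq_fun do rewrite linearBl/=.
  by apply: measurable_funB => //; exact: measurable_cst.
have [h [sh hg hc]] := simple_approximation X_separable mgd.
have sg E : strongly_measurable E g by exists h => // t _; exact: hc.
have mng : measurable_fun setT (fun t => `|g t|).
  by have := mgd 0; under eq_fun do rewrite subr0.
have mvar E : measurable E -> variation S nu E = m E by move=> ?; rewrite mE.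
exists g; split.
  split=> //; rewrite (eq_integral_measurable S _ mvar).
  apply: (@le_lt_trans _ _ (\int[m]_(t in S) (cst 1%E t))%E).
    apply: ge0_le_integral => //.
    - exact/measurable_EFinP/measurable_funTS.
    - by move=> t _; rewrite lee_fin.
  by rewrite integral_cst// mul1e ltey_eq fin_num_measure.
move=> E mEE ES; exists h.
have c0 : (\int[m]_(t in E) `|g t - h n t|%:E)%E @[n --> \oo] --> 0%E.
  have mgh n : measurable_fun E (fun t => `|g t - h n t|%:E).
    by apply/measurable_EFinP; exact: strongly_measurableB.
  have [|||||_ _ +] := @dominated_convergence _ _ _ m E mEE
     (fun n t => `|g t - h n t|%:E) (cst 0%E) (cst 1%E).
  - by [].
  - exact: measurable_cst.
  - apply: aeW => t Et; apply: cvg_EFin; first exact: nearW.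
    rewrite -(normr0 X) -(subrr (g t)); apply: cvg_norm; apply: cvgB => //; exact: cvg_cst.
  - exact: finite_measure_integrable_cst.
  - apply: aeW => t n Et; rewrite /= lee_fin normr_id.
    exact: le_trans (hg n t) (g1 t).
  - by rewrite integral0.
have sE n : simple_integral (variation S nu) E (h n) = simple_integral m E (h n).
  rewrite /simple_integral; apply: eq_fsbigr => x _; rewrite mE//.
  by apply: measurableI => //; case: (sh n).
split=> //.
  rewrite (_ : (fun n => _) = fun n => (\int[m]_(t in E) `|g t - h n t|%:E)%E)//.
  by apply/funext => n; exact: eq_integral_measurable.
rewrite (funext sE).
have gint u : m.-integrable E (fun t => (pairing (g t) u)%:E).
  apply: (pairing_integrable pairing_predual) => //.
  apply: (@le_lt_trans _ _ (\int[m]_(t in E) (cst 1%E t))%E).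
    apply: ge0_le_integral => //.
    - exact/measurable_EFinP/measurable_funTS.
    - by move=> t _; rewrite lee_fin.
  by rewrite integral_cst// mul1e ltey_eq fin_num_measure.
have key n : (`|nu E - simple_integral m E (h n)|%:E <= \int[m]_(t in E) `|g t - h n t|%:E)%E.
  apply/lee_addgt0Pr => e e0.
  have [i] := (u_norming.2) (nu E - simple_integral m E (h n)) e e0.
  rewrite ltrBlDr => /ltW le; apply: (@le_trans _ _ ((pairing (nu E - simple_integral m E (h n)) (u_ i))%:E + e%:E)%E).
    by rewrite -EFinD lee_fin.
  rewrite leeD2r// linearBl/= EFinB.
  have := pairing_integral_le pairing_predual mEE (sg E) (sh n) (gint (u_ i)).
  rewrite gI// (setIidl ES) => H; apply: le_trans (lee_abs _) _; apply: le_trans H _.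
  rewrite -[leRHS]mul1e; apply: lee_wpmul2r; first exact: integral_ge0.
  by rewrite lee_fin; apply u_norming.
apply/cvgrPdist_lt => e e0.
have /fine_cvgP[fin /cvgrPdist_lt/(_ _ e0) cc] := c0.
near=> n.
have fn : (\int[m]_(t in E) `|g t - h n t|%:E)%E \is a fin_num by near: n.
have : `|0 - fine (\int[m]_(t in E) `|g t - h n t|%:E)%E| < e by near: n.
rewrite sub0r normrN ger0_norm; last by apply: fine_ge0; exact: integral_ge0.
apply: le_lt_trans; rewrite -lee_fin fineK//.
Unshelve. all: by end_near.
Qed.

End RadonNikodymProperty.

(** * Helly's selection principle for integer-valued functions *)

(** Otherwise each level is eventually respected on one side. Either two consecutive levels enclose
    the sequence, which makes it constant, or it climbs past every level and so past its bound. *)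
Lemma not_eventually_constant (f : nat -> nat) b : (forall n, f n <= b)%N ->
  ~ (exists c, \forall n \near \oo, f n = c) ->
  exists p, ~ (\forall n \near \oo, f n < p)%N /\ ~ (\forall n \near \oo, p <= f n)%N.
Proof.
move=> fb nc; apply: contrapT => H; apply: nc.
have D p : (\forall n \near \oo, f n < p)%N \/ (\forall n \near \oo, p <= f n)%N.
  have [?|h1] := pselect (\forall n \near \oo, f n < p)%N; first by left.
  have [?|h2] := pselect (\forall n \near \oo, p <= f n)%N; first by right.
  by case: H; exists p.
suff : exists p, (\forall n \near \oo, p <= f n)%N /\ (\forall n \near \oo, f n < p.+1)%N.
  move=> [p [h1 h2]]; exists p; apply: filterS2 h1 h2 => n h1 h2.
  by apply/eqP; rewrite eqn_leq -ltnS h2.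
apply: contrapT => nE.
suff : \forall n \near \oo, (b < f n)%N.
  by move=> /filter_ex[n]; rewrite ltnNge fb.
elim: b.+1 => [|p IH]; first by apply: nearW.
by case: (D p.+1) => // h; case: nE; exists p.
Qed.

Section Helly.
Context (R : realType) (D : set R) (q : nat -> R -> nat) (b : nat).
Context (D_itv : is_interval D) (q_bounded : forall n t, D t -> (q n t <= b)%N).
Context (q_monotone : \forall n \near \oo, forall s t, D s -> D t -> s <= t -> (q n s <= q n t)%N).
Context (q_rat : forall r : rat, D (ratr r) -> exists c, \forall n \near \oo, q n (ratr r) = c).

Lemma monotone_cvg_off_countable :
  countable [set t | D t /\ ~ exists c, \forall n \near \oo, q n t = c].
Proof.
set N := [set t | _].
have /choice[p pP] : forall t, exists p, N t -> ~ (\forall n \near \oo, q n t < p)%N /\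
    ~ (\forall n \near \oo, p <= q n t)%N.
  move=> t; have [[Dt nc]|nt] := pselect (N t); last by exists 0%N.
  by have [p pP] := @not_eventually_constant (q ^~ t) b (fun n => q_bounded n Dt) nc; exists p.
(* p t is crossed infinitely often by (q n t)_n, so p is increasing on N. *)
have lt s t : N s -> N t -> s < t -> (p s < p t)%N.
  (* At a rational point between s and t the sequence settles at some c, and monotonicity in t gives
     p s <= c < p t. *)
  move=> Ns Nt st; have [r] := rat_in_itvoo st; rewrite in_itv/= => /andP[sr rt].
  have Dr : D (ratr r) by apply: (D_itv Ns.1 Nt.1); rewrite (ltW sr) (ltW rt).
  have [c cP] := q_rat Dr.
  have pc : (p s <= c)%N.
    rewrite leqNgt; apply/negP => cp; have [h _] := pP s Ns; apply: h.
    near=> n; apply: leq_ltn_trans cp.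
    have <- : q n (ratr r) = c by near: n.
    by apply: (near q_monotone n) => //; [exact: Ns.1|exact: ltW].
  apply: leq_ltn_trans pc _; rewrite ltnNge; apply/negP => pc.
  have [_ h] := pP t Nt; apply: h; near=> n; apply: leq_trans pc _.
  have <- : q n (ratr r) = c by near: n.
  by apply: (near q_monotone n) => //; [exact: Nt.1|exact: ltW].
apply/countable_injP; exists p => s t /set_mem Ns /set_mem Nt pst.
case: (ltgtP s t) => // st; [have := lt _ _ Ns Nt st|have := lt _ _ Nt Ns st];
  by rewrite pst ltnn.
Unshelve. all: by end_near.
Qed.

End Helly.

(** * Step functions and the coupling of discrete measures *)

Section StepFunctions.
Context (R : realType) (K : choiceType) (x0 : K).
Implicit Types (l : seq (R * K)) (a t : R).

(** The quantile function of the discrete measure with weighted atoms [l], in the order of the list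
    and started at [a]; [x0] fills the line to the right of the total weight. *)
Fixpoint step l a t : K :=
  if l is (w, x) :: l' then if t < a + w then x else step l' (a + w) t else x0.

Definition total l : R := \sum_(p <- l) p.1.

Lemma step_preimage_measurable l a (P : set K) : measurable (step l a @^-1` P).
Proof.
elim: l a => [|[w x] l IH] a /=.
  have [Px|Px] := pselect (P x0).
    by rewrite (_ : _ @^-1` _ = setT)//; apply/seteqP; split.
  by rewrite (_ : _ @^-1` _ = set0)//; apply/seteqP; split.
rewrite (_ : _ @^-1` P = (`]-oo, a + w[ `&` [set _ | P x]) `|`
    (`[a + w, +oo[ `&` step l (a + w) @^-1` P)); last first.
  apply/seteqP; split=> t /=; rewrite !in_itv/= ?andbT.
    by case: ltP => h Pt; [left|right].
  by case: ltP => h [] [].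
apply: measurableU; apply: measurableI => //.
have [Px|Px] := pselect (P x).
  by rewrite (_ : [set _ | _] = setT)//; apply/seteqP; split.
by rewrite (_ : [set _ | _] = set0)//; apply/seteqP; split.
Qed.

Lemma total_cons w x l : total ((w, x) :: l) = w + total l.
Proof. by rewrite /total big_cons. Qed.

Lemma total_ge0 l : (forall p, p \in l -> 0 <= p.1) -> 0 <= total l.
Proof. by move=> l0; rewrite /total big_seq sumr_ge0. Qed.

Lemma step_mem l a t : a <= t < a + total l -> step l a t \in map snd l.
Proof.
elim: l a => [|[w x] l IH] a.
  by rewrite /total big_nil addr0 => /andP[/le_lt_trans h /h]; rewrite ltxx.
rewrite total_cons addrA /= inE => /andP[a_t t_l]; case: ltP => h; first by rewrite eqxx.
by rewrite IH ?orbT// h.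
Qed.

Lemma step_monotone l a (p : K -> nat) s t : sorted (fun x y => p x <= p y)%N (map snd l) ->
  a <= s -> s <= t -> t < a + total l -> (p (step l a s) <= p (step l a t))%N.
Proof.
elim: l a => [|[w x] l IH] a.
  by rewrite /total big_nil addr0 => _ a1 a2 /(le_lt_trans (le_trans a1 a2)); rewrite ltxx.
rewrite total_cons addrA /= => so a_s st tl.
case: ltP => hs; case: ltP => ht.
- exact: leqnn.
- have := order_path_min (leT := fun x y => p x <= p y)%N (fun _ _ _ => @leq_trans _ _ _) so.
  move=> /allP; apply; apply: step_mem; exact/andP.
- by have := le_lt_trans st ht; rewrite ltNge hs.
- by apply: IH => //; exact: path_sorted so.
Qed.

Lemma integral_step l a (F : K -> \bar R) : (forall p, p \in l -> 0 <= p.1) ->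
  (\int[lebesgue_measure]_(t in `[a, (a + total l)%R[) F (step l a t) =
   \sum_(p <- l) p.1%:E * F p.2)%E.
Proof.
elim: l a => [|[w x] l IH] a l0.
  by rewrite big_nil /total big_nil addr0 set_itvco0 integral_set0.
have w0 : 0 <= w by apply: (l0 (w, x)); rewrite mem_head.
have l0' p : p \in l -> 0 <= p.1 by move=> pl; apply: l0; rewrite in_cons pl orbT.
have tl0 := total_ge0 l0'.
rewrite total_cons big_cons /=.
have -> : `[a, a + (w + total l)[%classic = `[a, a + w[%classic `|` `[a + w, a + w + total l[%classic.
  apply/seteqP; split=> t /=; rewrite !in_itv/= addrA.
    by move=> /andP[-> ->]; rewrite andbT; case: ltP; [left|right].
  by case=> /andP[h1 h2]; apply/andP; split=> //; lra.
rewrite integral_setU//=.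
- congr (_ + _)%E.
    transitivity (\int[lebesgue_measure]_(t in `[a, (a + w)%R[) (cst (F x) t))%E.
      by apply: eq_integral => t; rewrite inE/= in_itv/= => /andP[_ ->].
    rewrite integral_cst//= lebesgue_measure_itv/= lte_fin ltrDl.
    have [wp|] := ltP 0 w; first by rewrite -EFinB addrAC subrr add0r muleC.
    by move=> w0'; rewrite (_ : w = 0) ?mule0 ?mul0e//; apply/eqP; rewrite eq_le w0 w0'.
  rewrite -(IH (a + w))//; apply: eq_integral => t; rewrite inE/= in_itv/= => /andP[h _].
  by rewrite ltNge h.
- apply: (@measurable_funS _ _ _ _ setT) => //.
  move=> _ Y mY; rewrite setTI.
  exact: (step_preimage_measurable ((w, x) :: l) a (F @^-1` Y)).
- apply/disj_setPS => t /= []; rewrite !in_itv/= => /andP[_ h1] /andP[h2 _].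
  by have := lt_le_trans h1 h2; rewrite ltxx.
Qed.

End StepFunctions.

Section Coupling.
Context (R : realType) (K : choiceType) (x0 : K) (cell : nat -> K -> nat) (radix : nat -> nat).
Context (cell_lt : forall k x, (cell k x < radix k)%N).
Context (L : nat -> seq (R * K)) (L_ge0 : forall n p, p \in L n -> 0 <= p.1).
Context (L_total : forall n, total (L n) = 1).

(** The number with mixed-radix digits [cell 0 x], ..., [cell (k-1) x], the first being the most
    significant. Comparing codes is comparing digits lexicographically, and division by [radix k]
    drops the last digit of the code of level k + 1. *)
Fixpoint prefix_code k x : nat :=
  if k is k'.+1 then (prefix_code k' x * radix k' + cell k' x)%N else 0%N.

Lemma prefix_codeS_div k x : (prefix_code k.+1 x %/ radix k)%N = prefix_code k x.
Proof.
have c := cell_lt k x; rewrite /= divnMDl; last exact: leq_ltn_trans c.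
by rewrite divn_small ?addn0.
Qed.

Lemma prefix_codeS_mod k x : (prefix_code k.+1 x %% radix k)%N = cell k x.
Proof. by rewrite /= modnMDl modn_small. Qed.

Lemma prefix_code_le k n x y : (k <= n)%N -> (prefix_code n x <= prefix_code n y)%N ->
  (prefix_code k x <= prefix_code k y)%N.
Proof.
elim: n => [|n IH]; first by rewrite leqn0 => /eqP ->.
rewrite leq_eqVlt => /predU1P[->//|kn] /(leq_div2r (radix n)).
by rewrite !prefix_codeS_div; exact: IH.
Qed.

Lemma prefix_code_bounded : exists b : nat -> nat, forall k x, (prefix_code k x <= b k)%N.
Proof.
suff /choice[b bP] : forall k, exists b, forall x, (prefix_code k x <= b)%N by exists b.
move=> k.
elim: k => [|k [b IH]]; first by exists 0%N.
exists (b * radix k + radix k)%N => x; apply: leq_add; last exact: ltnW.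
by rewrite leq_mul2r IH orbT.
Qed.

Let D : set R := `[0, 1[%classic.

Let sorted_L n := sort (fun p r : R * K => prefix_code n p.2 <= prefix_code n r.2)%N (L n).

Let psi n t := step x0 (sorted_L n) 0 t.

Let sorted_L_ge0 n p : p \in sorted_L n -> 0 <= p.1.
Proof. by rewrite mem_sort; exact: L_ge0. Qed.

Let sorted_L_total n : 0 + total (sorted_L n) = 1.
Proof. by rewrite add0r -(L_total n) /total (perm_big (L n))// perm_sort. Qed.

(* The order of level n refines those of all the levels k <= n. *)
Let psi_monotone k n s t : (k <= n)%N -> D s -> D t -> s <= t ->
  (prefix_code k (psi n s) <= prefix_code k (psi n t))%N.
Proof.
rewrite /D/= !in_itv/= => kn /andP[s0 s1] /andP[t0 t1] st; apply: prefix_code_le kn _.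
apply: step_monotone => //; last by rewrite sorted_L_total.
rewrite sorted_map; apply: sort_sorted => p r; exact: leq_total.
Qed.

Lemma monotone_coupling : exists (sigma : nat -> nat) (phi : nat -> R -> K),
  [/\ {homo sigma : m n / (m < n)%N},
      forall n (P : set K), measurable (phi n @^-1` P),
      forall k t, exists c, \forall n \near \oo, cell k (phi n t) = c,
      forall n t, phi n t = x0 \/ phi n t \in map snd (L (sigma n)) &
      forall n (F : K -> \bar R), (\int[lebesgue_measure]_(t in `[0%R, 1%R[) F (phi n t) =
        \sum_(p <- L (sigma n)) p.1%:E * F p.2)%E].
Proof.
have [b bP] := prefix_code_bounded.
pose a (i : nat) n := if @unpickle (nat * rat)%type i is Some (k, r)
  then prefix_code k (psi n (ratr r)) else 0%N.
pose ab (i : nat) := if @unpickle (nat * rat)%type i is Some (k, r) then b k else 0%N.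
have [i n|sigma hs sP] := @diagonal_subsequence a ab.
  by rewrite /a /ab; case: unpickle => // -[k r].
pose N : set R := \bigcup_k [set t | D t /\
  ~ exists c, \forall n \near \oo, prefix_code k (psi (sigma n) t) = c].
have cN : countable N.
  apply: bigcup_countable => // k _.
  apply: (@monotone_cvg_off_countable _ D (fun n t => prefix_code k (psi (sigma n) t)) (b k)).
  - exact: interval_is_interval.
  - by move=> n t _; exact: bP.
  - exists k => // n /= kn s t; apply: psi_monotone.
    exact: leq_trans kn (subseq_ge hs n).
  - move=> r _; have [c] := sP (pickle (k, r)); rewrite /a pickleK => ?.
    by exists c.
have mN : measurable N by exact: countable_measurable.
have N0 : lebesgue_measure N = 0%E by exact: countable_lebesgue_measure0.
(* Constancy on the countable exceptional set and outside [0, 1[ makes convergence hold at every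
   point, without changing any integral over [0, 1[. *)
pose phi n t := if pselect (D t /\ ~ N t) then psi (sigma n) t else x0.
have phiE n t : D t -> ~ N t -> phi n t = psi (sigma n) t.
  by move=> Dt Nt; rewrite /phi; case: pselect => // -[].
have mphi n P : measurable (phi n @^-1` P).
  rewrite (_ : _ @^-1` P = ((D `\` N) `&` psi (sigma n) @^-1` P) `|`
      (~` (D `\` N) `&` [set _ | P x0])); last first.
    apply/seteqP; split=> t; rewrite /phi /preimage/=; case: pselect => h.
    - by left.
    - by right.
    - by case=> -[].
    - by case=> -[].
  have mDN : measurable (D `\` N) by apply: measurableD => //; exact: measurable_itv.
  apply: measurableU; apply: measurableI => //.
  - exact: step_preimage_measurable.
  - exact: measurableC.
  - have [Px|Px] := pselect (P x0).
      by rewrite (_ : [set _ | _] = setT)//; apply/seteqP; split.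
    by rewrite (_ : [set _ | _] = set0)//; apply/seteqP; split.
exists sigma, phi; split=> //.
- move=> k t; have [[Dt Nt]|h] := pselect (D t /\ ~ N t); last first.
    by exists (cell k x0); apply: nearW => n; rewrite /phi; case: pselect.
  (* Level k + 1 is used because [cell k] is the last digit of the code of that level. *)
  have [c cP] : exists c, \forall n \near \oo, prefix_code k.+1 (psi (sigma n) t) = c.
    by apply: contrapT => nc; apply: Nt; exists k.+1.
  exists (c %% radix k)%N; apply: filterS cP => n <-.
  by rewrite prefix_codeS_mod phiE.
- move=> n t; rewrite /phi; case: pselect => [[Dt Nt]|]; [right|by left].
  rewrite -(perm_mem (perm_map snd (permEl (perm_sort
    (fun p r : R * K => prefix_code (sigma n) p.2 <= prefix_code (sigma n) r.2)%N _)))).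
  by apply: step_mem; rewrite sorted_L_total; move: Dt; rewrite /D/= in_itv.
- move=> n F.
  transitivity (\int[lebesgue_measure]_(t in `[0%R, 1%R[) F (psi (sigma n) t))%E.
    have mF (f : R -> K) : (forall P : set K, measurable (f @^-1` P)) ->
        measurable_fun D (F \o f).
      move=> mf; apply: (@measurable_funS _ _ _ _ setT) => // _ Y mY.
      by rewrite setTI comp_preimage; exact: mf.
    apply: ae_eq_integral => //; [exact: (mF (phi n))|apply: (mF (psi (sigma n)))|].
      by move=> P; exact: step_preimage_measurable.
    exists N; split=> // t /= h; apply: contrapT => Nt; apply: h => Dt.
    by rewrite phiE.
  rewrite -[X in `[_, X[](sorted_L_total (sigma n)) integral_step; last exact: sorted_L_ge0.
  by apply: perm_big; rewrite perm_sort.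
Qed.

End Coupling.

Lemma cvg_rV (R : realType) d (s_ : nat -> 'rV[R]_d) (s : 'rV[R]_d) :
  (forall j, s_ n ord0 j @[n --> \oo] --> s ord0 j) -> s_ @ \oo --> s.
Proof.
move=> H; apply/cvg_ballP => e e0.
have : \forall n \near \oo, forall j, ball (s ord0 j) e (s_ n ord0 j).
  by apply: filter_forall => j; have /cvg_ballP/(_ _ e0) := H j.
apply: filterS => n Hn; split=> // i j; rewrite [i]ord1; exact: Hn.
Qed.

(** * Pointwise limits of bounded atoms *)

Section AtomicCompactness.
Context (R : realType) (X Xs : normedModType R).
Context (pairing : {bilinear X -> Xs -> R | *%R & *%R}).
Context (pairing_predual : is_predual pairing).
Context (u_ : nat -> Xs) (u_norming : norming pairing u_).
Context (d : nat) (S : set 'rV[R]_d) (S_compact : compact S) (s0 : 'rV[R]_d) (Ss0 : S s0).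
Context (M : R) (M0 : 0 <= M).
Context (L : nat -> seq (R * (X * 'rV[R]_d))) (L_ge0 : forall n p, p \in L n -> 0 <= p.1).
Context (L_total : forall n, total (L n) = 1).
Context (L_in : forall n p, p \in L n -> `|p.2.1| <= M /\ S p.2.2).

Lemma compact_coordinate_bounded : exists B : 'I_d -> R,
  forall j, 0 <= B j /\ forall s, S s -> `|s ord0 j| <= B j.
Proof.
suff /choice : forall j, exists B, 0 <= B /\ forall s : 'rV[R]_d, S s -> `|s ord0 j| <= B.
  by case=> B HB; exists B.
move=> j.
have cS : compact ((fun s : 'rV[R]_d => s ord0 j) @` S).
  apply: continuous_compact => //; apply: continuous_subspaceT.
  exact: coord_continuous.
have [B [_ HB]] := compact_bounded cS.
exists (`|B| + 1); split=> [|s Ss]; first by rewrite addr_ge0.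
apply: (HB (`|B| + 1)); last by exists s.
by apply: le_lt_trans (ler_norm _) _; rewrite ltrDl.
Qed.

Lemma atomic_compactness : exists (sigma : nat -> nat) (phi : nat -> R -> X * 'rV[R]_d)
    (v : R -> X) (s : R -> 'rV[R]_d),
  [/\ {homo sigma : m n / (m < n)%N},
      forall n P, measurable (phi n @^-1` P),
      forall n t, `|(phi n t).1| <= M /\ S (phi n t).2,
      forall t, [/\ `|v t| <= M, S (s t),
        forall u, pairing (phi n t).1 u @[n --> \oo] --> pairing (v t) u &
        (phi n t).2 @[n --> \oo] --> s t] &
      forall n (F : X * 'rV[R]_d -> \bar R),
        (\int[lebesgue_measure]_(t in `[0%R, 1%R[) F (phi n t) =
          \sum_(p <- L (sigma n)) p.1%:E * F p.2)%E].
Proof.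
have [B BP] := compact_coordinate_bounded.
(* The coordinates of a pair (x, s) are the pairings of x with the norming sequence and the d
   components of s. Shifted by their bounds they lie in [0, 2 off], and the cells are the integer
   parts of all their multiples. *)
pose I := (nat + 'I_d)%type.
pose off (i : I) := match i with inl _ => M | inr j => B j end.
pose z (i : I) (x : X * 'rV[R]_d) : R :=
  match i with inl i => pairing x.1 (u_ i) | inr j => x.2 ord0 j end.
pose y i x := z i x + off i.
have yP i x : `|x.1| <= M -> S x.2 -> 0 <= y i x <= 2 * off i.
  move=> xM Sx; have : `|z i x| <= off i.
    case: i => [i|j] /=; last by apply: (BP j).2.
    apply: le_trans (pairing_le pairing_predual _ _) _.
    by rewrite -[leRHS]mulr1 ler_pM//; apply u_norming.
  by rewrite ler_norml /y; move: (z i x) (off i) => a b /andP[? ?]; apply/andP; split; lra.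
pose radix k := if @unpickle (I * nat)%type k is Some (i, m)
  then (Num.truncn (m.+1%:R * (2 * off i))).+1 else 1%N.
pose cell k x := if @unpickle (I * nat)%type k is Some (i, m)
  then minn (Num.truncn (m.+1%:R * y i x)) (Num.truncn (m.+1%:R * (2 * off i))) else 0%N.
(* The minimum is inactive for `|x.1| <= M and S x.2; it only makes cell_lt hold
   everywhere. *)
have cell_lt k x : (cell k x < radix k)%N.
  by rewrite /cell /radix; case: unpickle => // -[i m]; rewrite ltnS geq_minr.
have [sigma [phi [hs mphi cphi mem_phi int_phi]]] :=
  monotone_coupling (0, s0) cell_lt L_ge0 L_total.
have phiP n t : `|(phi n t).1| <= M /\ S (phi n t).2.
  case: (mem_phi n t) => [->|/mapP[p pL ->]]; first by rewrite normr0.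
  exact: L_in pL.
have cy t i : cvgn (fun n => y i (phi n t)).
  apply: cvg_truncn => [n|m].
    by have [h1 h2] := phiP n t; have /andP[] := yP i _ h1 h2.
  have [c] := cphi (pickle (i, m)) t; rewrite /cell pickleK => cP.
  exists c; apply: filterS cP => n <-; apply/esym/minn_idPl; apply: le_truncn.
  by rewrite ler_wpM2l//; have [h1 h2] := phiP n t; have /andP[] := yP i _ h1 h2.
have cu t i : cvgn (fun n => pairing (phi n t).1 (u_ i)).
  rewrite (_ : (fun _ => _) = (fun n => y (inl i) (phi n t) - M)).
    by apply: is_cvgB; [exact: (cy t (inl i))|exact: is_cvg_cst].
  by apply/funext => n; rewrite /y /z /= addrK.
have /choice[v vP] : forall t, exists v, `|v| <= M /\
    forall u, pairing (phi n t).1 u @[n --> \oo] --> pairing v u.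
  move=> t; have [||v v1 v2] := @weak_star_complete _ _ _ _ pairing_predual u_
    (fun n => (phi n t).1) M u_norming; last by exists v.
  - by move=> n; have [] := phiP n t.
  - exact: cu.
have /choice[s sP] : forall t, exists s : 'rV[R]_d, (phi n t).2 @[n --> \oo] --> s.
  move=> t; exists (\row_j (limn (fun n => y (inr j) (phi n t)) - B j)).
  apply: cvg_rV => j; rewrite mxE.
  rewrite (_ : (fun _ => _) = (fun n => y (inr j) (phi n t) - B j)).
    by apply: cvgB; [exact: (cy t (inr j))|exact: cvg_cst].
  by apply/funext => n; rewrite /y /z /= addrK.
exists sigma, phi, v, s; split=> // t.
have [v1 v2] := vP t; split=> //.
have cS : closed S by apply: compact_closed => //; exact: norm_hausdorff.
apply: (closed_cvg _ cS _ _ (sP t)); apply: nearW => n; by have [] := phiP n t.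
Qed.

End AtomicCompactness.

(** * Replacing a vector measure by finitely many atoms *)

Section Discretization.
Context d (T : measurableType d) (R : realType) (X : normedModType R).

(** If every value exceeded the average by more than [e], so would the average itself. When the
    integral is infinite, any point of [Q] works. *)
Lemma mean_value (m : {finite_measure set T -> \bar R}) (Q : set T) (f : T -> \bar R) (e : R) :
  measurable Q -> m Q != 0%E -> measurable_fun Q f -> (forall t, Q t -> 0 <= f t)%E -> 0 < e ->
  exists2 t, Q t & (m Q * f t <= \int[m]_(t in Q) f t + e%:E * m Q)%E.
Proof.
move=> mQ Q0 mf f0 e0; apply: contrapT => H.
have mQf : m Q \is a fin_num by exact: fin_num_measure.
have mQp : 0 < fine (m Q) by rewrite fine_gt0// lt_neqAle eq_sym Q0 measure_ge0 ltey_eq mQf.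
have lt t : Q t -> (\int[m]_(t in Q) f t + e%:E * m Q < m Q * f t)%E.
  by move=> Qt; rewrite ltNge; apply/negP => le; apply: H; exists t.
have i0 : (0 <= \int[m]_(t in Q) f t)%E by exact: integral_ge0.
have [t0 Qt0] : Q !=set0.
  by apply/set0P; apply: contraNneq Q0 => ->; rewrite measure0.
have If : (\int[m]_(t in Q) f t)%E \is a fin_num.
  rewrite ge0_fin_numE// ltNge leye_eq; apply/negP => /eqP Ioo.
  have := lt _ Qt0; rewrite Ioo -(fineK mQf) -EFinM addye//.
  by rewrite ltNge leey.
set I := (\int[m]_(t in Q) f t)%E in i0 If lt.
pose c := (fine I + e * fine (m Q)) / fine (m Q).
have cf t : Q t -> (c%:E <= f t)%E.
  move=> Qt; rewrite -(@lee_pmul2l _ (fine (m Q))%:E)// -EFinM /c mulrCA divff ?gt_eqF// mulr1.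
  by rewrite EFinD EFinM !fineK//; exact: ltW (lt _ Qt).
have : (c%:E * m Q <= I)%E.
  rewrite -integral_cst//; apply: ge0_le_integral => //.
  move=> t _; rewrite lee_fin /c divr_ge0 ?(ltW mQp)// addr_ge0 ?fine_ge0//.
  by rewrite mulr_ge0 ?(ltW e0) ?(ltW mQp).
rewrite -(fineK mQf) -EFinM /c divfK ?gt_eqF// -[in X in (_ <= X)%E](fineK If) lee_fin.
by apply/negP; rewrite -ltNge ltrDl mulr_gt0.
Qed.

Context (S : set T) (mS : measurable S) (s0 : T) (Ss0 : S s0).
Context (nu : set T -> X) (m : {finite_measure set T -> \bar R}).
Context (mE : forall E, measurable E -> m E = variation S nu E).
Context (g : T -> X) (g_density : is_density S nu g).
Context (J : X -> T -> \bar R) (J_ge0 : forall x t, S t -> (0 <= J x t)%E).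
Context (J_homo : forall t, S t -> positively_homogeneous (J ^~ t)).
Context (mJ : measurable_fun S (fun t => J (g t) t)).
Context (V : R) (JV : (\int[m]_(t in S) J (g t) t <= V%:E)%E).

(** A simple function [h] near the density [g] only supplies the partition; the atoms carry sampled
    values of [g], because lower semicontinuity gives no upper bound for [J] at values of [h]. *)
Lemma density_discretization (e : R) : 0 < e -> exists l : seq (X * T),
  [/\ forall p, p \in l -> S p.2, (\sum_(p <- l) J p.1 p.2 <= (V + e)%:E)%E &
      `|nu S - \sum_(p <- l) p.1| <= e].
Proof.
move=> e0.
have [[sg _] gB] := g_density.
have [h [sh h0 hnu]] := gB S mS (@subset_refl _ _).
have V0 : 0 <= V by rewrite -lee_fin; apply: le_trans JV; apply: integral_ge0 => t St; exact: J_ge0.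
have e2 : 0 < e / 2 by rewrite divr_gt0.
(* The sampled penalty will be at most V + e, and dividing by [K] turns this into an error of at
   most e / 2 for the total mass. *)
pose K := (V + e) / (e / 2).
have K0 : 0 < K by rewrite divr_gt0// ltr_wpDl.
have eK : 0 < e / 2 / K by rewrite divr_gt0.
have {}h0 : (\int[m]_(t in S) `|g t - h n t|%:E)%E @[n --> \oo] --> 0%E.
  rewrite (_ : (fun n => _) = fun n => (\int[variation S nu]_(t in S) `|g t - h n t|%:E)%E)//.
  by apply/funext => n; exact: eq_integral_measurable.
have [n [hn1 hn2]] : exists n, (\int[m]_(t in S) `|g t - h n t|%:E <= (e / 2 / K)%:E)%E /\
    `|nu S - simple_integral m S (h n)| <= e / 2.
  have /fine_cvgP[fin /cvgrPdist_lt/(_ _ eK) c1] := h0.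
  have /cvgrPdist_lt/(_ _ e2) c2 := hnu.
  have [n [[n1 n2] n3]] := filter_ex (filterI (filterI fin c1) c2).
  exists n; split.
    rewrite -(fineK n1) lee_fin; apply: ltW; apply: le_lt_trans n2.
    by rewrite sub0r normrN ler_norm.
  rewrite (_ : simple_integral m S (h n) = simple_integral (variation S nu) S (h n)); first exact: ltW.
  rewrite /simple_integral; apply: eq_fsbigr => x _; rewrite mE//.
  by apply: measurableI => //; case: (sh n).
have {sh} := sh n; move: (h n) hn1 hn2 => {h h0 hnu} h hn1 hn2 sh.
have [fh mh] := sh.
pose r : seq X := fset_set (range h).
pose Q x := S `&` h @^-1` [set x].
have mQ x : measurable (Q x) by exact: measurableI.
have mQf x : m (Q x) \is a fin_num by exact: fin_num_measure.
(* The penalty K * `|g - h| forces the points sampled from F to give a good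
   approximation of the total mass, while its integral is at most e / 2. *)
pose F t := (J (g t) t + K%:E * `|g t - h t|%:E)%E.
have F0 t : S t -> (0 <= F t)%E.
  by move=> St; rewrite adde_ge0 ?J_ge0// -EFinM lee_fin mulr_ge0// ltW.
have mgh : measurable_fun S (fun t => `|g t - h t|%:E).
  exact/measurable_EFinP/strongly_measurableB.
have mF : measurable_fun S F.
  by apply: emeasurable_funD => //; apply: emeasurable_funM.
(* The sampling slacks add up to [D * m S], at most e / 2; the added 1 covers the case m S = 0. *)
pose D := e / (2 * (fine (m S) + 1)).
have mS1 : 0 < fine (m S) + 1 by rewrite ltr_wpDl// fine_ge0.
have D0 : 0 < D by rewrite divr_gt0// mulr_gt0.
have /choice[s sP] : forall x, exists s, S s /\
    (m (Q x) * (J (g s) s + K%:E * `|g s - x|%:E) <= \int[m]_(t in Q x) F t + D%:E * m (Q x))%E.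
  move=> x; have [Qx0|Qx0] := eqVneq (m (Q x)) 0%E.
    (* On a null cell the atom has weight 0, so its position is arbitrary. *)
    exists s0; split=> //; rewrite Qx0 mul0e mule0 adde0.
    by apply: integral_ge0 => t [St _]; exact: F0.
  have [||t [St /= <-] le] := @mean_value m (Q x) F D (mQ x) Qx0 _ _ D0; last by exists t.
  - by apply: measurable_funS mF => // t [].
  - by move=> t [St _]; exact: F0.
pose a x := fine (m (Q x)).
have a0 x : 0 <= a x by exact: fine_ge0.
have SQ : S = \big[setU/set0]_(x <- r) Q x.
  apply/seteqP; split=> t.
    move=> St; rewrite -bigcup_seq; exists (h t) => //=.
    by rewrite in_fset_set//; apply: mem_set; exists t.
  by rewrite -bigcup_seq => -[x _ []].
have trQ : trivIset [set` r] Q.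
  by move=> x y _ _ [t [[_ /= <-] [_ /= <-]]].
have intF : (\sum_(x <- r) \int[m]_(t in Q x) F t = \int[m]_(t in S) F t)%E.
  rewrite [in RHS]SQ ge0_integral_bigsetU//; rewrite ?fset_uniq// -SQ//.
have summ : (\sum_(x <- r) m (Q x) = m S)%E.
  rewrite -[RHS]mul1e -integral_cst// [in RHS]SQ ge0_integral_bigsetU ?fset_uniq// -?SQ//.
  by apply: eq_bigr => x _; rewrite integral_cst// mul1e.
have intFle : (\int[m]_(t in S) F t <= (V + e / 2)%:E)%E.
  rewrite ge0_integralD//; [|by move=> t St; exact: J_ge0| |exact: emeasurable_funM].
    rewrite EFinD; apply: leeD => //.
    rewrite ge0_integralZl//; last by rewrite lee_fin ltW.
    apply: le_trans (lee_wpmul2l _ hn1) _; first by rewrite lee_fin ltW.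
    by rewrite -EFinM lee_fin mulrCA divff ?mulr1// gt_eqF.
  by move=> t _; rewrite -EFinM lee_fin mulr_ge0// ltW.
have Dle : (D%:E * m S <= (e / 2)%:E)%E.
  rewrite -(fineK (fin_num_measure m S mS)) -EFinM lee_fin /D invfM.
  rewrite (_ : _ * fine (m S) = (e / 2) * (fine (m S) / (fine (m S) + 1))); last by ring.
  by rewrite ler_piMr ?(ltW e2)// ler_pdivrMr// mul1r lerDl.
have key : (\sum_(x <- r) (a x)%:E * (J (g (s x)) (s x) + K%:E * `|g (s x) - x|%:E) <= (V + e)%:E)%E.
  apply: (@le_trans _ _ (\sum_(x <- r) (\int[m]_(t in Q x) F t + D%:E * m (Q x)))%E).
    by apply: lee_sum => x _; rewrite /a fineK//; have [] := sP x.
  rewrite big_split/= intF -ge0_sume_distrr//=.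
  rewrite summ (_ : (V + e)%:E = ((V + e / 2)%:E + (e / 2)%:E)%E); first exact: leeD.
  by rewrite -EFinD -addrA -splitr.
have J0 x : (0 <= J (g (s x)) (s x))%E by apply: J_ge0; have [] := sP x.
exists [seq (a x *: g (s x), s x) | x <- r]; split.
- by move=> p /mapP[x _ ->] /=; have [] := sP x.
- rewrite big_map /=; apply: le_trans key; apply: lee_sum => x _.
  have [Ss _] := sP x; rewrite (J_homo Ss)//; apply: lee_wpmul2l; first by rewrite lee_fin.
  by rewrite leeDl// -EFinM lee_fin mulr_ge0// ltW.
- rewrite big_map /=.
  have le2 : K * \sum_(x <- r) a x * `|g (s x) - x| <= V + e.
    rewrite -lee_fin; apply: le_trans key; rewrite mulr_sumr -sumEFin; apply: lee_sum => x _.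
    rewrite mulrCA EFinM; apply: lee_wpmul2l; first by rewrite lee_fin.
    by rewrite EFinM leeDr.
  have le3 : \sum_(x <- r) a x * `|g (s x) - x| <= e / 2.
    rewrite -(ler_pM2l K0); apply: le_trans le2 _.
    by rewrite /K divfK// gt_eqF.
  have -> : nu S - \sum_(x <- r) a x *: g (s x) =
      (nu S - simple_integral m S h) - \sum_(x <- r) a x *: (g (s x) - x).
    rewrite /simple_integral fsbig_finite//= -/r.
    rewrite (eq_bigr (fun x => a x *: g (s x) - a x *: x) (fun x _ => scalerBr _ _ _)).
    by rewrite sumrB opprB addrA subrK.
  apply: le_trans (ler_normB _ _) _; rewrite [leRHS]splitr; apply: lerD => //.
  apply: le_trans le3; apply: le_trans (ler_norm_sum _ _ _) _.
  by apply: ler_sum => x _; rewrite normrZ ger0_norm.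
Qed.

End Discretization.

(** * Vector measures pushed forward from the parameter space *)

Section PushedVectorMeasure.
Context (R : realType) (X Xs : normedModType R).
Context (pairing : {bilinear X -> Xs -> R | *%R & *%R}).
Context (pairing_predual : is_predual pairing).
Context (u_ : nat -> Xs) (u_norming : norming pairing u_).
Context d1 (Omega : measurableType d1) (lam : {measure set Omega -> \bar R}).
Context (D : set Omega) (mD : measurable D) (lamD : (lam D < +oo)%E).
Context d (T : measurableType d) (s : Omega -> T) (v : Omega -> X) (M : R) (M0 : 0 <= M).
Context (vM : forall t, D t -> `|v t| <= M).
Context (mv : forall u, measurable_fun D (fun t => pairing (v t) u)).
Context (ms : forall E, measurable E -> measurable (D `&` s @^-1` E)).

Lemma bounded_integrable_sub (A : set Omega) (f : Omega -> R) B :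
  measurable A -> A `<=` D -> measurable_fun D f -> (forall t, D t -> `|f t| <= B) ->
  lam.-integrable A (EFin \o f).
Proof.
move=> mA AD mf fB; apply: (integrableS mD mA AD).
apply/integrableP; split; first exact/measurable_EFinP.
apply: (@le_lt_trans _ _ (\int[lam]_(t in D) cst (`|B|%:E) t)%E).
  apply: ge0_le_integral => //.
  - by apply: measurableT_comp => //; exact/measurable_EFinP.
  - by move=> t Dt /=; rewrite lee_fin; apply: le_trans (fB t Dt) (ler_norm _).
rewrite integral_cst// -(@fineK _ (lam D)) ?ge0_fin_numE// -EFinM.
exact: ltry.
Qed.

Lemma pairing_integrable_sub (A : set Omega) u : measurable A -> A `<=` D ->
  lam.-integrable A (fun t => (pairing (v t) u)%:E).
Proof.
move=> mA AD; apply: (@bounded_integrable_sub A (fun t => pairing (v t) u) (M * `|u|)) => // t Dt.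
by apply: le_trans (pairing_le pairing_predual _ _) _; rewrite ler_wpM2r// vM.
Qed.

Lemma fin_num_sub (A : set Omega) : measurable A -> A `<=` D -> lam A \is a fin_num.
Proof.
move=> mA AD; rewrite ge0_fin_numE//; apply: le_lt_trans lamD.
by apply: le_measure => //; exact: mem_set.
Qed.

Lemma pairing_integral_bound (A : set Omega) u : measurable A -> A `<=` D ->
  `|fine (\int[lam]_(t in A) (pairing (v t) u)%:E)%E| <= M * fine (lam A) * `|u|.
Proof.
move=> mA AD; have ip := pairing_integrable_sub u mA AD.
have If : (\int[lam]_(t in A) (pairing (v t) u)%:E)%E \is a fin_num by exact: integrable_fin_num.
rewrite -lee_fin -abse_EFin fineK//.
apply: le_trans (le_abse_integral _ mA _) _; first by case/integrableP: ip.
apply: (@le_trans _ _ (\int[lam]_(t in A) cst ((M * `|u|)%:E) t)%E).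
  apply: ge0_le_integral => //.
  - by apply: measurableT_comp => //; case/integrableP: ip.
  - move=> t At; rewrite /= lee_fin; apply: le_trans (pairing_le pairing_predual _ _) _.
    by rewrite ler_wpM2r// vM//; exact: AD.
by rewrite integral_cst// -(fineK (fin_num_sub mA AD)) -EFinM lee_fin mulrAC.
Qed.

(** The map v is only weak* measurable, so its integral is a Gelfand integral: the scalar integrals
    define a bounded functional on Xs, represented by a point of X. The norm bound gives finite
    variation and additivity in norm. *)
Lemma pushed_exists : exists mu : set T -> X, forall E, measurable E ->
  (forall u, (pairing (mu E) u)%:E = \int[lam]_(t in D `&` s @^-1` E) (pairing (v t) u)%:E)%E /\
  `|mu E| <= M * fine (lam (D `&` s @^-1` E)).
Proof.
suff /choice[mu muP] : forall E, exists x, measurable E ->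
  (forall u, (pairing x u)%:E = \int[lam]_(t in D `&` s @^-1` E) (pairing (v t) u)%:E)%E /\
  `|x| <= M * fine (lam (D `&` s @^-1` E)) by exists mu.
move=> E; have [mE|nE] := pselect (measurable E); last by exists 0.
set A := D `&` _; have mA : measurable A by exact: ms.
have AD : A `<=` D by exact: subIsetl.
have fin u : (\int[lam]_(t in A) (pairing (v t) u)%:E)%E \is a fin_num.
  by apply: integrable_fin_num => //; exact: pairing_integrable_sub.
have [|a u w|u|x xL xM] := @pairing_represent _ _ _ _ pairing_predual
  (fun u => fine (\int[lam]_(t in A) (pairing (v t) u)%:E)%E) (M * fine (lam A)).
- by rewrite mulr_ge0// fine_ge0.
- apply: EFin_inj; rewrite EFinD EFinM !fineK//.
  rewrite -integralZl//; last exact: pairing_integrable_sub.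
  rewrite -integralD//; [|apply: integrableZl => //|]; try exact: pairing_integrable_sub.
  by apply: eq_integral => t _; rewrite linearDr linearZr.
- exact: pairing_integral_bound.
- by exists x => _; split=> // u; rewrite xL fineK.
Qed.

Context (mu : set T -> X) (muP : forall E, measurable E ->
  (forall u, (pairing (mu E) u)%:E = \int[lam]_(t in D `&` s @^-1` E) (pairing (v t) u)%:E)%E /\
  `|mu E| <= M * fine (lam (D `&` s @^-1` E))).

Lemma pushed_setU E F : measurable E -> measurable F -> E `&` F = set0 ->
  mu (E `|` F) = mu E + mu F.
Proof.
move=> mE mF EF; apply/eqP; rewrite -subr_eq0; apply/eqP.
apply: (norming_separates u_norming) => i; rewrite linearBl/= linearDl/=.
apply/eqP; rewrite subr_eq0; apply/eqP; apply: EFin_inj; rewrite EFinD.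
rewrite (muP (measurableU _ _ mE mF)).1 (muP mE).1 (muP mF).1.
rewrite preimage_setU setIUr integral_setU//; [exact: ms|exact: ms| |].
- apply/measurable_EFinP; apply: (measurable_funS mD) => //.
  by move=> t [] [].
- apply/disj_setPS => t /= [[_ Et] [_ Ft]].
  by have : (E `&` F) (s t) by []; rewrite EF.
Qed.

Lemma pushed0 : mu set0 = 0.
Proof.
have := pushed_setU measurable0 measurable0 (set0I set0); rewrite setU0 => h.
by apply: (addrI (mu set0)); rewrite addr0 -h.
Qed.

Lemma pushed_bigcup_lt (F : nat -> set T) n : (forall i, measurable (F i)) -> trivIset setT F ->
  mu (\bigcup_(i < n) F i) = \sum_(i < n) mu (F i).
Proof.
move=> mF tF; elim: n => [|n IH]; first by rewrite bigcup_mkord !big_ord0 pushed0.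
rewrite bigcup_mkord !big_ord_recr/= -bigcup_mkord -IH pushed_setU//.
  exact: bigcup_measurable.
apply/seteqP; split=> // x [[i /= ilt Fi] Fn].
have /= := tF i n Logic.I Logic.I (ex_intro _ x (conj Fi Fn)).
by move=> iE; rewrite iE ltnn in ilt.
Qed.

(** The error after n terms is the mass of the tail, whose norm is at most M times the measure of a
    decreasing sequence of sets with empty intersection. Hence convergence in norm, although mu is
    defined weakly. *)
Lemma pushed_countably_additive S : countably_additive S mu.
Proof.
move=> F mF _ tF.
pose tail n := \bigcup_(i in [set i | (n <= i)%N]) F i.
have mtail n : measurable (tail n) by exact: bigcup_measurable.
have split_tail n : \bigcup_i F i = (\bigcup_(i < n) F i) `|` tail n.
  apply/seteqP; split=> x.
    by move=> [i _ Fi]; case: (ltnP i n) => ?; [left|right]; exists i.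
  by case=> -[i _ Fi]; exists i.
have disj n : (\bigcup_(i < n) F i) `&` tail n = set0.
  apply/seteqP; split=> // x [[i /= ilt Fi] [j /= jn Fj]].
  have /= ij := tF i j Logic.I Logic.I (ex_intro _ x (conj Fi Fj)).
  by move: jn; rewrite -ij leqNgt ilt.
have diff n : mu (\bigcup_i F i) - \sum_(i < n) mu (F i) = mu (tail n).
  rewrite (split_tail n) pushed_setU//; last exact: bigcup_measurable.
  by rewrite pushed_bigcup_lt// addrAC subrr add0r.
pose A n := D `&` s @^-1` (tail n).
have mA n : measurable (A n) by exact: ms.
have A0 : \bigcap_n A n = set0.
  apply/seteqP; split=> // t At; have [Dt [i _ Fi]] := At 0%N Logic.I.
  have [_ [j /= ij Fj]] := At i.+1 Logic.I.
  have /= e := tF i j Logic.I Logic.I (ex_intro _ (s t) (conj Fi Fj)).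
  by rewrite e ltnn in ij.
have cA : lam (A n) @[n --> \oo] --> 0%E.
  rewrite -(measure0 lam) -A0; apply: nonincreasing_cvg_mu => //.
  - by rewrite -ge0_fin_numE//; apply: fin_num_sub => //; exact: subIsetl.
  - by rewrite A0.
  - move=> m n mn; apply/subsetPset => t [Dt [i /= ni Fi]]; split=> //.
    by exists i => //=; exact: leq_trans ni.
apply/cvgrPdist_lt => e e0.
have e1 : 0 < e / (M + 1) by rewrite divr_gt0// ltr_wpDl.
have /fine_cvgP[_ /cvgrPdist_lt/(_ _ e1)] := cA.
apply: filterS => n; rewrite sub0r normrN ger0_norm ?fine_ge0// => lt.
rewrite diff; apply: le_lt_trans (muP (mtail n)).2 _.
have M1 : 0 < M + 1 by rewrite ltr_wpDl.
move: lt; rewrite /= ltr_pdivlMr// mulrC; apply: le_lt_trans.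
by rewrite ler_wpM2r ?fine_ge0// lerDl.
Qed.

Lemma pushed_variation_le S : (variation S mu S <= (M * fine (lam D))%:E)%E.
Proof.
apply: ge_ereal_sup => _ [n [A [mA tA UA ->]]]; rewrite lee_fin.
apply: (@le_trans _ _ (\sum_(i < n) M * fine (lam (D `&` s @^-1` (A i))))).
  by apply: ler_sum => i _; exact: (muP (mA i)).2.
rewrite -mulr_sumr ler_wpM2l//.
have fi i : lam (D `&` s @^-1` (A i)) \is a fin_num.
  by apply: fin_num_sub; [exact: ms|exact: subIsetl].
rewrite -lee_fin -sumEFin fineK; last by rewrite ge0_fin_numE.
rewrite (eq_bigr (fun i => lam (D `&` s @^-1` (A i)))); last by move=> i _; rewrite fineK.
have mU : measurable (\big[setU/set0]_(i < n) (D `&` s @^-1` A i)).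
  by apply: bigsetU_measurable => i _; exact: ms.
rewrite -measure_semi_additive_ord//.
- apply: le_measure; rewrite ?inE//.
  apply: (big_ind (fun B => B `<=` D)) => [//|B C BD CD t|i _ t []//].
  by move=> [/BD|/CD].
- by move=> i; exact: ms.
- by move=> i j _ _ [t [[_ Ai] [_ Aj]]]; apply: tA => //; exists (s t).
Qed.

Lemma pushed_vector_measure S : vector_measures S mu.
Proof.
split; first exact: pushed_countably_additive.
by apply: le_lt_trans (pushed_variation_le S) _; exact: ltry.
Qed.

End PushedVectorMeasure.

(** * Jensen's inequality for the pushed measure *)

Section Jensen.
Context (R : realType) (X Xs : normedModType R).
Context (pairing : {bilinear X -> Xs -> R | *%R & *%R}).
Context (pairing_predual : is_predual pairing).
Context (u_ : nat -> Xs) (u_norming : norming pairing u_).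
Context (V : normedModType R) (S : set V) (S_closed : closed S).
Context (J : X -> V -> \bar R) (C : R) (C0 : 0 < C).
Context (J_ge0 : forall v s, S s -> (0 <= J v s)%E).
Context (J_convex : forall s, S s -> convex_efun (J ^~ s)).
Context (J_homo : forall s, S s -> positively_homogeneous (J ^~ s)).
Context (J_coercive : forall v s, S s -> (`|v|%:E <= C%:E * J v s)%E).
Context (J_lsc : forall (v_ : nat -> X) (v : X) (s_ : nat -> V) (s : V),
  (forall n, S (s_ n)) -> S s ->
  (forall u, pairing (v_ n) u @[n --> \oo] --> pairing v u) -> s_ @ \oo --> s ->
  (J v s <= limn_einf (fun n => J (v_ n) (s_ n)))%E).

Let mini i := minorized pairing u_ S J i : set (borel V).

Let mmini i : measurable (mini i).
Proof.
exact: (measurable_minorized pairing_predual u_norming S_closed J_ge0 J_homo J_lsc).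
Qed.

Let Jsup x t : S t -> J x t = ereal_sup (range (fun i => (minorant pairing u_ S J i x t)%:E)).
Proof.
exact: (integrand_sup pairing_predual u_norming C0 J_ge0 J_convex J_homo J_coercive J_lsc).
Qed.

Lemma minorant_measurable d (T : measurableType d) (D : set T) (f : T -> X) (tau : T -> V) i :
  measurable D -> (forall u, measurable_fun D (fun t => pairing (f t) u)) ->
  (forall E : set (borel V), measurable E -> measurable (D `&` tau @^-1` E)) ->
  measurable_fun D (fun t => minorant pairing u_ S J i (f t) (tau t)).
Proof.
move=> mD mf mtau; apply: measurable_funM => //.
rewrite (_ : (fun x => _) = \1_(tau @^-1` mini i)); last by apply/funext => t; rewrite !indicE.
have mI : measurable_fun D (\1_(D `&` tau @^-1` mini i) : T -> R).
  by apply: measurable_indic; exact: mtau.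
apply: eq_measurable_fun mI => t; rewrite inE => Dt.
rewrite !indicE; congr (_%:R); congr nat_of_bool.
by apply/idP/idP; rewrite !inE => // -[].
Qed.

(** Weak* measurability of [f] suffices because [J] is a countable supremum of functions linear in
    the vector, with Borel coefficients in the point. *)
Lemma integrand_measurable d (T : measurableType d) (D : set T) (f : T -> X) (tau : T -> V) :
  measurable D -> (forall u, measurable_fun D (fun t => pairing (f t) u)) ->
  (forall E : set (borel V), measurable E -> measurable (D `&` tau @^-1` E)) ->
  (forall t, D t -> S (tau t)) ->
  measurable_fun D (fun t => J (f t) (tau t)).
Proof.
move=> mD mf mtau DS.
have ms : measurable_fun D (fun t => ereal_sup (range (fun i =>
    (minorant pairing u_ S J i (f t) (tau t))%:E))).
  apply: measurable_fun_ereal_sup_range => i; apply/measurable_EFinP.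
  exact: minorant_measurable.
by apply: eq_measurable_fun ms => t; rewrite inE => Dt; rewrite Jsup//; exact: DS.
Qed.

Context d1 (Omega : measurableType d1) (lam : {measure set Omega -> \bar R}).
Context (D : set Omega) (mD : measurable D).
Context (s : Omega -> V) (v : Omega -> X).
Context (mv : forall u, measurable_fun D (fun t => pairing (v t) u)).
Context (ms : forall E : set (borel V), measurable E -> measurable (D `&` s @^-1` E)).
Context (sS : forall t, D t -> S (s t)).
Context (m : {measure set (borel V) -> \bar R}) (g : borel V -> X).
Context (mg : forall u, measurable_fun (S : set (borel V)) (fun t => pairing (g t) u)).
Context (gv : forall (E : set (borel V)) u, measurable E -> E `<=` S ->
  (\int[m]_(t in E) (pairing (g t) u)%:E =
   \int[lam]_(t in D `&` s @^-1` E) (pairing (v t) u)%:E)%E).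

Let a i (t : borel V) := minorant pairing u_ S J i (g t) t.

(** Running maxima of the minorants, increasing to [J] on [S]. Starting from 0 keeps them
    nonnegative, as monotone convergence requires, and stays below [J]. *)
Let psi := fix psi k (t : borel V) : R :=
  if k is k'.+1 then Num.max (psi k' t) (a k' t) else 0.

Let mS : measurable (S : set (borel V)). Proof. exact: closed_borel. Qed.

Let ma i : measurable_fun (S : set (borel V)) (a i).
Proof.
apply: (@minorant_measurable _ (borel V) S g id) => // E mE; rewrite preimage_id.
exact: measurableI.
Qed.

Let psiS k t : psi k.+1 t = Num.max (psi k t) (a k t).
Proof. by []. Qed.

Let psi_ge0 k t : 0 <= psi k t.
Proof. by elim: k => [//|k IH]; rewrite psiS le_max IH. Qed.

Let mpsi k : measurable_fun (S : set (borel V)) (psi k).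
Proof.
elim: k => [|k IH].
  exact: measurable_cst.
rewrite (_ : psi k.+1 = psi k \max a k); last by apply/funext => t; rewrite psiS.
exact: measurable_maxr.
Qed.

Let mJv (A : set Omega) : measurable A -> A `<=` D -> measurable_fun A (fun t => J (v t) (s t)).
Proof.
move=> mA AD; apply: (measurable_funS mD AD).
by apply: integrand_measurable.
Qed.

(** On [mini i] the minorant is a pairing with one fixed slope, so its integral passes from g to v
    by [gv]; there it lies below J(v, s). *)
Let a_le i (E : set (borel V)) : measurable E -> E `<=` S ->
  (\int[m]_(t in E) (a i t)%:E <= \int[lam]_(t in D `&` s @^-1` E) J (v t) (s t))%E.
Proof.
move=> mE ES.
have -> : (\int[m]_(t in E) (a i t)%:E =
    \int[m]_(t in E `&` mini i) (pairing (g t) (slope u_ i))%:E)%E.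
  rewrite integral_mkcondr; apply: eq_integral => t _.
  rewrite /a /minorant patchE indicE; case: (boolP (t \in mini i)) => _; first by rewrite mul1r.
  by rewrite mul0r.
rewrite gv//; [|exact: measurableI|by apply: subset_trans ES; exact: subIsetl].
set A := D `&` s @^-1` (E `&` mini i); set B := D `&` s @^-1` E.
have mA : measurable A by apply: ms; exact: measurableI.
have mB : measurable B by exact: ms.
have AB : A `<=` B by move=> t [? []].
have AD : A `<=` D by exact: subIsetl.
have mf : measurable_fun A (fun t => (pairing (v t) (slope u_ i))%:E).
  by apply/measurable_EFinP; exact: measurable_funS (mv _).
have J0 t : B t -> (0 <= J (v t) (s t))%E by move=> [Dt _]; exact: J_ge0 (sS Dt).
apply: (@le_trans _ _ (\int[lam]_(t in A) J (v t) (s t))%E); last first.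
  by apply: ge0_subset_integral => //; apply: mJv => //; exact: subIsetl.
(* The pairing may be negative; its positive part is still below [J], which is nonnegative. *)
rewrite integralE; apply: (@le_trans _ _
    (\int[lam]_(t in A) ((fun t => (pairing (v t) (slope u_ i))%:E)^\+ t))%E).
  rewrite -[leRHS]adde0 leeD2l// oppe_le0; by apply: integral_ge0.
apply: ge0_le_integral => //.
- exact: measurable_funepos.
- exact: mJv.
- move=> t At; rewrite funeposE ge_max J0 ?andbT; last exact: AB.
  by case: At => _ [_ [_]]; apply.
Qed.

(** [E] is split according to which term attains the maximum: one part is covered by induction, the
    other by [a_le]. This is why the bound is stated for all measurable E. *)
Let psi_le k (E : set (borel V)) : measurable E -> E `<=` S ->
  (\int[m]_(t in E) (psi k t)%:E <= \int[lam]_(t in D `&` s @^-1` E) J (v t) (s t))%E.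
Proof.
have J0 t : D t -> (0 <= J (v t) (s t))%E by move=> Dt; exact: J_ge0 (sS Dt).
elim: k E => [|k IH] E mE ES.
  have -> : (\int[m]_(t in E) (psi 0 t)%:E = 0)%E by rewrite integral0_eq.
  apply: integral_ge0 => t [Dt _]; exact: J0.
pose E1 := E `&` [set t | a k t <= psi k t].
pose E2 := E `\` [set t | a k t <= psi k t].
have mE1 : measurable E1.
  by apply: measurable_fun_le => //; [exact: measurable_funS (ma k)|exact: measurable_funS (mpsi k)].
have mE2 : measurable E2.
  rewrite (_ : E2 = E `\` E1); first exact: measurableD.
  by apply/seteqP; split=> t [Et h]; split=> //; [case|move=> ?; apply: h].
have E12 : E = E1 `|` E2 by rewrite /E1 /E2 setUIDK.
have dE : [disjoint E1 & E2] by apply/disj_setPS => t [[_ h1] [_ /(_ h1)]].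
have E1S : E1 `<=` S by move=> t [/ES].
have E2S : E2 `<=` S by move=> t [/ES].
rewrite {1}E12 ge0_integral_setU//; last 2 first.
- by rewrite -E12; apply/measurable_EFinP; exact: measurable_funS (mpsi k.+1).
- by move=> t _; rewrite lee_fin.
rewrite [in leRHS]E12 preimage_setU setIUr ge0_integral_setU//; [|exact: ms|exact: ms| | |]; last 3 first.
- by apply: mJv; [apply: measurableU; exact: ms|move=> t [[]|[]]].
- by move=> t [] [Dt _]; exact: J0.
- by apply/disj_setPS => t [[_ h1] [_ h2]]; move/disj_setPS: dE; apply; split; [exact: h1|exact: h2].
apply: leeD.
  apply: le_trans (IH E1 mE1 E1S); rewrite le_eqVlt; apply/orP; left; apply/eqP.
  by apply: eq_integral => t; rewrite inE => -[_ /= h]; rewrite (max_idPl h).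
apply: le_trans (a_le k mE2 E2S); rewrite le_eqVlt; apply/orP; left; apply/eqP.
apply: eq_integral => t; rewrite inE => -[_ /= /negP]; rewrite -ltNge => h.
by rewrite (max_idPr (ltW h)).
Qed.

Lemma integrand_jensen :
  (\int[m]_(t in S) J (g t) t <= \int[lam]_(t in D) J (v t) (s t))%E.
Proof.
have psi_nd t : {homo (fun k => (psi k t)%:E) : n k / (n <= k)%N >-> (n <= k)%E}.
  by apply: homo_leq => [x //|x y z|k]; [exact: le_trans|rewrite lee_fin psiS le_max lexx].
have Jpsi t : S t -> J (g t) t = limn (fun k => (psi k t)%:E).
  move=> St; rewrite (cvg_lim _ (ereal_nondecreasing_cvgn (psi_nd t)))// Jsup//.
  apply/eqP; rewrite eq_le; apply/andP; split.
    apply: ge_ereal_sup => _ [i _ <-]; apply: (@le_trans _ _ (psi i.+1 t)%:E).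
      by rewrite lee_fin psiS le_max lexx orbT.
    by apply: ereal_sup_ubound; exists i.+1.
  apply: ge_ereal_sup => _ [k _ <-]; rewrite -Jsup//.
  elim: k => [|k IH]; first exact: J_ge0.
  rewrite psiS EFin_max ge_max IH/=; exact: minorant_le.
rewrite (eq_integral (fun t => limn (fun k => (psi k t)%:E))); last first.
  by move=> t; rewrite inE => St; exact: Jpsi.
rewrite (@monotone_convergence _ _ _ m S mS (fun k t => (psi k t)%:E)).
- apply: lime_le.
    apply: ereal_nondecreasing_is_cvgn => n k nk; apply: ge0_le_integral => //.
    + by move=> t _; rewrite lee_fin.
    + exact/measurable_EFinP.
    + exact/measurable_EFinP.
    + by move=> t _; exact: psi_nd.
  apply: nearW => k; apply: le_trans (psi_le k mS (@subset_refl _ _)) _.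
  rewrite (_ : D `&` s @^-1` S = D)//; apply/setIidl => t; exact: sS.
- by move=> k; exact/measurable_EFinP.
- by move=> k t _; rewrite lee_fin.
- by move=> t _; exact: psi_nd.
Qed.

End Jensen.

(** * The data term in the Hilbert space *)

Section Hilbert.
Context (R : realType) (Y : completeNormedModType R) (ip : {dot Y for (@idfun R)}).
Context (Y_hilbert : is_hilbert ip).

Lemma ip_sym y z : ip y z = ip z y.
Proof. by rewrite hermC expr0 mul1r. Qed.

Lemma sqr_normD y z : `|y + z| ^+ 2 = `|y| ^+ 2 + 2 * ip y z + `|z| ^+ 2.
Proof.
rewrite !Y_hilbert linearDl !linearDr/= (ip_sym z y).
by move: (ip y y) (ip y z) (ip z z) => a b c; ring.
Qed.

(** The tangent inequality that replaces weak lower semicontinuity of the norm: its left side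
    depends on [a] only through [ip y a], which passes to weak limits. *)
Lemma sqr_norm_lower y a b :
  `|y| ^+ 2 + 2 * (ip y a - ip y b) <= `|y + (a - b)| ^+ 2.
Proof.
have e : ip y (a - b) = ip y a - ip y b by rewrite linearDr linearNr.
by rewrite sqr_normD e lerDl sqr_ge0.
Qed.

Lemma ip_continuous y : continuous (ip y : Y -> R).
Proof.
have bd z : `|ip y z| <= (`|y| ^+ 2 + 1) * `|z|.
  have [->|z0] := eqVneq z 0; first by rewrite linear0r !normr0 mulr0.
  have n0 : 0 < `|z| by rewrite normr_gt0.
  (* Nonnegativity of the squared norms of y + w and y - w gives a crude form of Cauchy-Schwarz,
     enough for continuity. *)
  have bd1 w : `|w| = 1 -> `|ip y w| <= `|y| ^+ 2 + 1.
    move=> w1; have := sqr_ge0 `|y + w|; have := sqr_ge0 `|y - w|.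
    rewrite !sqr_normD normrN w1 linearNr/= expr1n => h1 h2.
    have := sqr_ge0 `|y|; move: (ip y w) (`|y| ^+ 2) h1 h2 => a b h1 h2 h3.
    by rewrite ler_norml; apply/andP; split; lra.
  have := bd1 (`|z|^-1 *: z).
  rewrite normrZ normfV normr_id mulVf ?gt_eqF// => /(_ erefl).
  by rewrite linearZr/= normrM normfV normr_id mulrC ler_pdivrMr.
pose ipl : Y -> R^o := ip y.
have lin : linear ipl by move=> a u w; rewrite /ipl linearDr linearZr.
pose ipM := GRing.isLinear.Build _ _ _ _ ipl lin.
pose phi : {linear Y -> R^o} := HB.pack ipl ipM.
suff : continuous phi by [].
apply/linear_bounded_continuous/linear_boundedP; exists (`|y| ^+ 2 + 1); split; first exact: num_real.
by move=> r yr z; apply: le_trans (bd z) _; rewrite ler_wpM2r// ltW.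
Qed.

Context (X Xs : normedModType R) (pairing : {bilinear X -> Xs -> R | *%R & *%R}).

Lemma weak_star_ip_cvg (A : X -> Y) (x_ : nat -> X) x y :
  weak_star_weak_continuous pairing A ->
  (forall u, pairing (x_ n) u @[n --> \oo] --> pairing x u) ->
  ip y (A (x_ n)) @[n --> \oo] --> ip y (A x).
Proof.
move=> Ac cx.
pose ipl : Y -> R^o := ip y.
have lin : linear ipl by move=> a u w; rewrite /ipl linearDr linearZr.
pose ipM := GRing.isLinear.Build _ _ _ _ ipl lin.
pose phi : {linear Y -> R^o} := HB.pack ipl ipM.
have cphi : continuous phi by exact: ip_continuous.
have c1 := cvg_comp _ _ (weak_star_cvg cx) (Ac x).
have c2 : (fun n => (fun psi => sval psi (A (x_ n))) : {ptws topological_dual Y -> R}) @ \oo -->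
    ((fun psi => sval psi (A x)) : {ptws topological_dual Y -> R}).
  exact: cvg_comp _ _ c1 (@initial_continuous _ _ _ (A x)).
move/cvg_sup : c2 => /(_ (exist _ phi cphi)) c3.
exact: cvg_comp _ _ c3 (@initial_continuous _ _ _ _).
Qed.

End Hilbert.

(** * Properties of the density, rescaled atoms, measurable limits *)

Lemma zero_vector_measure d (T : measurableType d) (R : realType) (X : normedModType R)
  (S : set T) : vector_measures S (fun=> 0 : X).
Proof.
split.
  move=> F _ _ _; rewrite (_ : (fun n => _) = cst 0); first exact: cvg_cst.
  by apply/funext => n; rewrite big1.
apply: (@le_lt_trans _ _ 0%E); last exact: ltry.
apply: ge_ereal_sup => _ [n [A [_ _ _ ->]]].
by rewrite big1// => i _; rewrite normr0.
Qed.

(** All that is used of [density] later on: existence rules out its default value, [m] stands in for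
    the variation, and the Bochner identities are reduced to pairings. *)
Lemma density_spec d (T : measurableType d) (R : realType) (X Xs : normedModType R)
    (pairing : {bilinear X -> Xs -> R | *%R & *%R}) (S : set T) (nu : set T -> X) :
  is_predual pairing -> separable X -> measurable S -> vector_measures S nu ->
  exists m : {finite_measure set T -> \bar R},
    [/\ forall E, measurable E -> m E = variation S nu E,
        is_density S nu (density S nu),
        forall u, measurable_fun S (fun t => pairing (density S nu t) u) &
        forall E u, measurable E -> E `<=` S ->
          (\int[m]_(t in E) (pairing (density S nu t) u)%:E = (pairing (nu E) u)%:E)%E].
Proof.
move=> Hp Xsep mS nuvm; have [nuadd nufin] := nuvm.
have [m mE] := variation_measure mS nuadd nufin.
have [u_ un] := norming_exists Hp Xsep.
have gd : is_density S nu (density S nu).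
  have [g gd] := density_exists Hp Xsep un mS nuvm mE.
  exact: (@xgetPex _ (fun=> 0) [set g | is_density S nu g]) (ex_intro _ g gd).
have [[sg ig] gB] := gd.
exists m; split=> // [u|E u mEE ES].
  by apply: (strongly_measurable_comp (phi := pairing ^~ u)) => //; exact: pairing_l_continuous.
have sgE : strongly_measurable E (density S nu).
  by case: sg => h sh hg; exists h => // t /ES; exact: hg.
have igS : (\int[m]_(t in S) `|density S nu t|%:E < +oo)%E.
  by rewrite (eq_integral_measurable S _ mE).
symmetry; apply: (bochner_integral_pairing Hp) => //.
  apply: le_lt_trans igS; apply: ge0_subset_integral => //.
  apply/measurable_EFinP; apply: (strongly_measurable_comp (phi := Num.norm)) => //.
  exact: norm_continuous.
have [h [sh h0 hx]] := gB E mEE ES; exists h; split=> //.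
  rewrite (_ : (fun n => _) = fun n => (\int[variation S nu]_(t in E) `|density S nu t - h n t|%:E)%E)//.
  by apply/funext => n; exact: eq_integral_measurable.
rewrite (_ : (fun n => _) = fun n => simple_integral (variation S nu) E (h n))//.
apply/funext => n; rewrite /simple_integral; apply: eq_fsbigr => x _; rewrite mE//.
by apply: measurableI => //; case: (sh n).
Qed.

Section Normalization.
Context (R : realType) (X : normedModType R) (V : choiceType).
Context (S : set V) (s0 : V) (Ss0 : S s0).
Context (J : X -> V -> \bar R).
Context (J_homo : forall s, S s -> positively_homogeneous (J ^~ s)).
Context (M : R) (M0 : 0 < M) (l : seq (X * V)).
Context (lS : forall p, p \in l -> S p.2).
Context (lM : \sum_(p <- l) `|p.1| <= M).

(* The first atom brings the total weight to 1. If p.1 = 0 then M / `|p.1| = 0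
   and the atom has weight 0. *)
Definition normalized : seq (R * (X * V)) :=
  (1 - \sum_(p <- l) `|p.1| / M, (0, s0)) ::
  [seq (`|p.1| / M, ((M / `|p.1|) *: p.1, p.2)) | p <- l].

Lemma normalized_ge0 p : p \in normalized -> 0 <= p.1.
Proof.
rewrite inE => /predU1P[->|/mapP[q _ ->]] /=; last by rewrite divr_ge0// ltW.
by rewrite subr_ge0 -mulr_suml ler_pdivrMr// mul1r.
Qed.

Lemma normalized_total : total normalized = 1.
Proof. by rewrite /total big_cons big_map/= subrK. Qed.

Lemma normalized_in p : p \in normalized -> `|p.2.1| <= M /\ S p.2.2.
Proof.
rewrite inE => /predU1P[->|/mapP[q ql ->]] /=; first by rewrite normr0 ltW.
split; last exact: lS.
have [->|q0] := eqVneq q.1 0; first by rewrite scaler0 normr0 ltW.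
rewrite normrZ normrM normfV normr_id -mulrA mulVf ?normr_eq0// mulr1.
by rewrite gtr0_norm.
Qed.

Lemma normalized_scale (x : X) : (`|x| / M) *: ((M / `|x|) *: x) = x.
Proof.
have [->|x0] := eqVneq x 0; first by rewrite !scaler0.
have xn : `|x| != 0 by rewrite normr_eq0.
have Mn : M != 0 by rewrite gt_eqF.
rewrite scalerA (_ : _ * _ = 1) ?scale1r//; field; exact/andP.
Qed.

(** Homogeneity moves each weight inside [J], and the padding atom costs nothing because J 0 s0 =
    0. *)
Lemma normalized_integrand :
  (\sum_(p <- normalized) p.1%:E * J p.2.1 p.2.2 = \sum_(p <- l) J p.1 p.2)%E.
Proof.
rewrite big_cons big_map/= (_ : J 0 s0 = 0%E); last first.
  by rewrite -(scale0r 0) (J_homo Ss0)// mul0e.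
rewrite mule0 add0e big_seq [RHS]big_seq; apply: eq_bigr => p pl.
by rewrite -(J_homo (lS pl)) ?normalized_scale// divr_ge0// ltW.
Qed.

Lemma normalized_pairing (Xs : normedModType R) (pairing : {bilinear X -> Xs -> R | *%R & *%R}) u :
  (\sum_(p <- normalized) p.1%:E * (pairing p.2.1 u)%:E = (pairing (\sum_(p <- l) p.1) u)%:E)%E.
Proof.
rewrite big_cons big_map/= linear0l mule0 add0e linear_sumlz -sumEFin.
by apply: eq_bigr => p _; rewrite -EFinM -linearZl normalized_scale.
Qed.

End Normalization.

(** A limit lies in an open set exactly when, for some radius, the balls of that radius around the
    terms eventually lie in it. Preimages of arbitrary sets under [s_ n] are measurable, so nothing
    is asked of the sets [Gk k]. *)
Lemma limit_preimage_measurable d (Omega : measurableType d) (R : realType) (V : normedModType R)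
    (s_ : nat -> Omega -> V) (s : Omega -> V) :
  (forall n (P : set V), measurable (s_ n @^-1` P)) ->
  (forall t, s_ n t @[n --> \oo] --> s t) ->
  forall E : set (borel V), measurable E -> measurable (s @^-1` E).
Proof.
move=> ms cs E mE.
suff : measurable_fun setT (s : Omega -> borel V).
  by move=> /(_ measurableT E mE); rewrite setTI.
apply: (@measurability _ _ Omega (borel V) setT s (@open V : set (set (borel V))) erefl) => // _ [G oG <-]; rewrite setTI.
pose Gk k := [set x : V | ball x k.+1%:R^-1 `<=` G].
have kp k : 0 < k.+1%:R^-1 :> R by rewrite invr_gt0 ltr0n.
have -> : s @^-1` G = \bigcup_k \bigcup_N \bigcap_(n in [set n | (N <= n)%N]) s_ n @^-1` (Gk k).
  apply/seteqP; split=> t.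
    move=> /= Gst; have := oG; rewrite openE => /(_ _ Gst) /nbhs_ballP[e /= e0 eG].
    have e2 : 0 < e / 2 by rewrite divr_gt0.
    have [k ke] := natSV_lt e2.
    have /cvg_ballP/(_ _ e2)[N _ Nb] := cs t.
    exists k => //; exists N => // n /= Nn y yb; apply: eG.
    rewrite [e]splitr; apply: ball_triangle (Nb n Nn) _.
    exact: le_ball (ltW ke) _ yb.
  move=> [k _ [N _ H]]; have /cvg_ballP/(_ _ (kp k))[N' _ Nb] := cs t.
  apply: (H (maxn N N') (leq_maxl _ _)); apply: ball_sym.
  exact: (Nb (maxn N N') (leq_maxr _ _)).
apply: bigcup_measurable => k _; apply: bigcup_measurable => N _.
apply: bigcap_measurable => [|n _]; [by exists N => /=|exact: ms].
Qed.

(** * Passage to the limit along a minimizing sequence *)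

Section Minimization.
Context (R : realType) (X Xs : completeNormedModType R).
Context (pairing : {bilinear X -> Xs -> R | *%R & *%R}).
Context (pairing_predual : is_predual pairing) (X_separable : separable X).
Context (Y : completeNormedModType R) (ip : {dot Y for (@idfun R)}) (Y_hilbert : is_hilbert ip).
Context (A : {linear X -> Y}) (A_continuous : weak_star_weak_continuous pairing A).
Context (f : Y) (alpha : R) (alpha_gt0 : 0 < alpha).
Context (d : nat) (S : set 'rV[R]_d) (s0 : 'rV[R]_d) (Ss0 : S s0) (S_compact : compact S).
Context (J : X -> 'rV[R]_d -> \bar R) (C : R) (C0 : 0 < C).
Context (J_ge0 : forall v s, S s -> (0 <= J v s)%E).
Context (J_convex : forall s, S s -> convex_efun (J ^~ s)).
Context (J_homo : forall s, S s -> positively_homogeneous (J ^~ s)).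
Context (J_coercive : forall v s, S s -> (`|v|%:E <= C%:E * J v s)%E).
Context (J_lsc : forall (v_ : nat -> X) (v : X) (s_ : nat -> 'rV[R]_d) (s : 'rV[R]_d),
  (forall n, S (s_ n)) -> S s ->
  (forall u, pairing (v_ n) u @[n --> \oo] --> pairing v u) -> s_ @ \oo --> s ->
  (J v s <= limn_einf (fun n => J (v_ n) (s_ n)))%E).

Let SB : set (borel 'rV[R]_d) := S.

Let S_closed : closed S.
Proof. by apply: compact_closed => //; exact: norm_hausdorff. Qed.

Let mS : measurable SB. Proof. exact: closed_borel. Qed.

Lemma density_integrand_measurable (u_ : nat -> Xs) (nu : set (borel 'rV[R]_d) -> X) :
  norming pairing u_ ->
  (forall u, measurable_fun SB (fun t => pairing (density SB nu t) u)) ->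
  measurable_fun SB (fun t => J (density SB nu t) t).
Proof.
move=> un mg.
have mid (E : set (borel 'rV[R]_d)) : measurable E -> measurable (SB `&` id @^-1` E).
  by move=> mE; rewrite preimage_id; exact: measurableI.
exact (@integrand_measurable _ _ _ _ pairing_predual u_ un _ S S_closed J C C0 J_ge0
  J_convex J_homo J_coercive J_lsc _ (borel 'rV[R]_d) SB (density SB nu) id mS mg mid (fun _ => id)).
Qed.

Lemma objective_discretization (nu : set (borel 'rV[R]_d) -> X) (I e : R) :
  vector_measures SB nu -> (objective SB A f alpha J nu <= I%:E)%E -> 0 < e ->
  exists l : seq (X * 'rV[R]_d),
    [/\ forall p, p \in l -> S p.2,
        (\sum_(p <- l) J p.1 p.2 <=
          ((I - 2^-1 * `|A (nu SB) - f| ^+ 2) / alpha + e)%:E)%E &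
        `|nu SB - \sum_(p <- l) p.1| <= e].
Proof.
move=> nuvm objI e0.
have [u_ un] := norming_exists pairing_predual X_separable.
have [m [mE gd mg gI]] := density_spec pairing_predual X_separable mS nuvm.
apply: (density_discretization mS Ss0 mE gd J_ge0 J_homo _ _ e0).
  exact: density_integrand_measurable un mg.
rewrite -(@lee_pmul2l _ alpha%:E)// -EFinM mulrC divfK ?gt_eqF//.
rewrite EFinB leeBrDl//; apply: le_trans objI; rewrite /objective.
by rewrite leeD2l// (eq_integral_measurable _ _ mE).
Qed.

Lemma minimizing_limit (nu : nat -> set (borel 'rV[R]_d) -> X) (I : R) :
  (forall n, vector_measures SB (nu n)) ->
  (forall n, objective SB A f alpha J (nu n) <= (I + n.+1%:R^-1)%:E)%E ->
  exists2 mu, vector_measures SB mu & (objective SB A f alpha J mu <= I%:E)%E.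
Proof.
move=> nuvm nuI.
have [u_ un] := norming_exists pairing_predual X_separable.
have np n : 0 < n.+1%:R^-1 :> R by rewrite invr_gt0 ltr0n.
have n1 n : n.+1%:R^-1 <= 1 :> R by rewrite invf_le1 ?ler1n ?ltr0n.
have /choice[l lP] := fun n => objective_discretization (nuvm n) (nuI n) (np n).
pose cost n := (I + n.+1%:R^-1 - 2^-1 * `|A (nu n SB) - f| ^+ 2) / alpha + n.+1%:R^-1.
have lS n p : p \in l n -> S p.2 by have [+ _ _] := lP n; apply.
have lcost n : (\sum_(p <- l n) J p.1 p.2 <= (cost n)%:E)%E by have [] := lP n.
(* [cost n] is at most |I + 1| / alpha + 1, as the data term is nonnegative and 1 / (n + 1) <= 1;
   coercivity contributes the factor [C]. The last 1 makes positivity of [M] immediate. *)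
pose M := C * (`|I + 1| / alpha + 1) + 1.
have M0 : 0 < M.
  by rewrite ltr_wpDl// mulr_ge0 ?(ltW C0)// addr_ge0// divr_ge0// ltW.
have lM n : \sum_(p <- l n) `|p.1| <= M.
  rewrite -lee_fin -sumEFin.
  apply: (@le_trans _ _ (C%:E * \sum_(p <- l n) J p.1 p.2)%E).
    rewrite big_seq [in leRHS]big_seq ge0_sume_distrr; last by move=> p /lS; exact: J_ge0.
    by apply: lee_sum => p /lS; exact: J_coercive.
  apply: le_trans (lee_wpmul2l _ (lcost n)) _; first by rewrite lee_fin ltW.
  rewrite -EFinM lee_fin /M; apply: (@le_trans _ _ (C * (`|I + 1| / alpha + 1))); last by rewrite lerDl.
  rewrite ler_pM2l// /cost lerD// ler_pM2r ?invr_gt0//.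
  apply: le_trans (ler_norm (I + 1)).
  have h : 0 <= 2^-1 * `|A (nu n SB) - f| ^+ 2 by rewrite mulr_ge0 ?invr_ge0 ?sqr_ge0.
  have := n1 n; move: (n.+1%:R^-1) (2^-1 * _) h => a b h a1; lra.
pose L n := normalized s0 M (l n).
have [sigma [phi [v [s [hs mphi phiP vsP intphi]]]]] := @atomic_compactness _ _ _ _
  pairing_predual u_ un d S S_compact s0 Ss0 M (ltW M0) L
  (fun n => @normalized_ge0 _ _ _ s0 M M0 (l n) (lM n))
  (fun n => normalized_total s0 M (l n))
  (fun n => normalized_in Ss0 M0 (lS n)).
pose lam : {measure set (measurableTypeR R) -> \bar R} := @lebesgue_measure R.
pose D : set R := `[0, 1[%classic.
have mD : measurable D by exact: measurable_itv.
have lamD : (lam D < +oo)%E.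
  suff -> : lam D = (1 - 0)%:E by exact: ltry.
  by have := lebesgue_measure_itv (`[0, 1[ : interval R); rewrite /= lte_fin ltr01.
have mphiF (F : X * 'rV[R]_d -> \bar R) n E : measurable_fun E (fun t => F (phi n t)).
  apply: (@measurable_funS _ _ _ _ setT) => // _ Z mZ; rewrite setTI.
  exact: (mphi n (F @^-1` Z)).
have mphi1 u n : measurable_fun setT (fun t => pairing (phi n t).1 u).
  apply/measurable_EFinP; exact (mphiF (fun p => (pairing p.1 u)%:E) n setT).
have mv u : measurable_fun D (fun t => pairing (v t) u).
  apply: (measurable_fun_cvg (h := fun n t => pairing (phi n t).1 u)).
    by move=> n; apply: measurable_funTS.
  by move=> t _; have [_ _ + _] := vsP t; apply.
have ms E : measurable (E : set (borel 'rV[R]_d)) -> measurable (D `&` s @^-1` E).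
  move=> mE; apply: measurableI => //.
  apply: (limit_preimage_measurable (s_ := fun n t => (phi n t).2)) mE.
    by move=> n P; exact: (mphi n (fun p => P p.2)).
  by move=> t; have [] := vsP t.
have vM t : D t -> `|v t| <= M by have [] := vsP t.
have sS t : D t -> S (s t) by have [] := vsP t.
have [mu muP] := pushed_exists (lam := lam) pairing_predual mD lamD (ltW M0) vM mv ms.
have muvm : vector_measures SB mu.
  exact: (pushed_vector_measure (lam := lam) un mD lamD (ltW M0) mv ms muP).
exists mu => //.
have muS u : (pairing (mu SB) u)%:E = (\int[lam]_(t in D) (pairing (v t) u)%:E)%E.
  rewrite (muP SB mS).1; congr (integral _ _ _).
  by apply/setIidl => t; exact: sS.
(* The total masses of the atoms converge by dominated convergence of the pairings on [0, 1[, and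
   they differ from the masses of the minimizing sequence by at most 1 / (n + 1) in norm. *)
have weak u : pairing (nu (sigma n) SB) u @[n --> \oo] --> pairing (mu SB) u.
  have c1 : pairing (\sum_(p <- l (sigma n)) p.1) u @[n --> \oo] --> pairing (mu SB) u.
    have [|||||_ _ +] := @dominated_convergence _ _ _ lam D mD
       (fun n t => (pairing (phi n t).1 u)%:E) (fun t => (pairing (v t) u)%:E)
       (cst (M * `|u|)%:E).
    - by move=> n; apply/measurable_EFinP; apply: measurable_funTS; exact: mphi1.
    - apply/measurable_EFinP; exact: mv.
    - apply: aeW => t Dt; apply: cvg_EFin; first exact: nearW.
      by have [_ _ + _] := vsP t; apply.
    - apply/integrableP; split; first exact: measurable_cst.
      under eq_integral do rewrite /= ger0_norm ?mulr_ge0 ?(ltW M0)//.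
      rewrite integral_cst// -(@fineK _ (lam D)) ?ge0_fin_numE// -EFinM.
      exact: ltry.
    - apply: aeW => t n Dt; rewrite /= lee_fin.
      apply: le_trans (pairing_le pairing_predual _ _) _; rewrite ler_wpM2r//.
      by have [] := phiP n t.
    rewrite -muS => H.
    suff H' : (pairing (\sum_(p <- l (sigma n)) p.1) u)%:E @[n --> \oo] --> (pairing (mu SB) u)%:E.
      exact: (fine_cvg H').
    apply: cvg_trans H; apply: near_eq_cvg; apply: nearW => n /=.
    by rewrite (intphi n (fun p => (pairing p.1 u)%:E)) normalized_pairing.
  rewrite -[pairing (mu SB) u]addr0.
  rewrite (_ : (fun n => _) = (fun n => pairing (\sum_(p <- l (sigma n)) p.1) u +
    pairing (nu (sigma n) SB - \sum_(p <- l (sigma n)) p.1) u)); last first.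
    by apply/funext => n; rewrite linearBl/= addrC subrK.
  apply: cvgD => //; apply/cvgrPdist_lt => e e0.
  have eu : 0 < e / (`|u| + 1) by rewrite divr_gt0// ltr_wpDl.
  have [k ke] := natSV_lt eu.
  exists k => // n /= kn; rewrite sub0r normrN.
  apply: le_lt_trans (pairing_le pairing_predual _ _) _.
  have [_ _ ln] := lP (sigma n).
  apply: (@le_lt_trans _ _ (k.+1%:R^-1 * `|u|)).
    rewrite ler_wpM2r//; apply: le_trans ln _.
    by rewrite lef_pV2 ?posrE ?ltr0n// ler_nat ltnS (leq_trans kn)//; exact: subseq_ge.
  move: ke; rewrite ltr_pdivlMr ?ltr_wpDl//; apply: le_lt_trans.
  by rewrite ler_wpM2l ?(ltW (np k))// lerDl.
pose y := A (mu SB) - f.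
have cip : ip y (A (nu (sigma n) SB)) @[n --> \oo] --> ip y (A (mu SB)).
  exact: weak_star_ip_cvg.
have hilb n : `|y| ^+ 2 + 2 * (ip y (A (nu n SB)) - ip y (A (mu SB))) <= `|A (nu n SB) - f| ^+ 2.
  have -> : A (nu n SB) - f = y + (A (nu n SB) - A (mu SB)).
    by rewrite /y [RHS]addrC addrA subrK.
  exact: sqr_norm_lower.
have [m [mE gd mg gI]] := density_spec pairing_predual X_separable mS muvm.
have jensen : (\int[m]_(t in SB) J (density SB mu t) t <= \int[lam]_(t in D) J (v t) (s t))%E.
  apply: (@integrand_jensen _ _ _ _ pairing_predual u_ un _ S S_closed J C C0 J_ge0
    J_convex J_homo J_coercive J_lsc _ _ lam D mD s v mv ms sS m (density SB mu) mg).
  by move=> E u mEE ES; rewrite gI// (muP E mEE).1.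
have fat : (\int[lam]_(t in D) J (v t) (s t) <=
    limn_einf (fun n => \int[lam]_(t in D) J (phi n t).1 (phi n t).2))%E.
  apply: le_trans (fatou lam mD (f := fun n t => J (phi n t).1 (phi n t).2) _ _).
  - apply: ge0_le_integral => //.
    + by move=> t Dt; apply: J_ge0; exact: sS.
    + apply: (@integrand_measurable _ _ _ _ pairing_predual u_ un _ S S_closed J C C0 J_ge0
        J_convex J_homo J_coercive J_lsc _ _ D v s) => //.
    + apply: measurableT_comp => //; apply: measurable_fun_limn_esup => n.
      by apply: measurableT_comp => //; exact: (mphiF (fun p => J p.1 p.2)).
    + move=> t Dt; have [_ St c1 c2] := vsP t; apply: J_lsc => // n.
      by have [] := phiP n t.
  - by move=> n; exact: (mphiF (fun p => J p.1 p.2)).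
  - by move=> n t Dt; apply: J_ge0; have [] := phiP n t.
pose bound := (I - 2^-1 * `|y| ^+ 2) / alpha.
have lim : (limn_einf (fun n => \int[lam]_(t in D) J (phi n t).1 (phi n t).2) <= bound%:E)%E.
  (* The data term enters the bound on the energy with a minus sign, so its tangent lower bound
     gives an upper bound. Unlike the data term itself, this expression is known to converge, and
     its limit is [bound]. *)
  pose ub n := (I + (sigma n).+1%:R^-1 - 2^-1 * (`|y| ^+ 2 +
    2 * (ip y (A (nu (sigma n) SB)) - ip y (A (mu SB))))) / alpha + (sigma n).+1%:R^-1.
  apply: (@limn_einf_le _ _ (fun n => (ub n)%:E)).
    apply: nearW => n; rewrite (intphi n (fun p => J p.1 p.2)).
    rewrite (normalized_integrand Ss0 J_homo M0 (lS (sigma n))).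
    apply: le_trans (lcost _) _; rewrite lee_fin /cost /ub lerD2r ler_pM2r ?invr_gt0//.
    by rewrite lerD2l lerN2 ler_pM2l ?invr_gt0.
  apply: cvg_EFin; first exact: nearW.
  have cn : (sigma n).+1%:R^-1 @[n --> \oo] --> (0 : R).
    by have := cvg_comp _ _ (cvg_subseq hs) (@cvg_harmonic R).
  have -> : bound = (I + 0 - 2^-1 * (`|y| ^+ 2 +
      2 * (ip y (A (mu SB)) - ip y (A (mu SB))))) / alpha + 0.
    by rewrite /bound subrr mulr0 !addr0.
  apply: cvgD => //; apply: cvgM; last exact: cvg_cst.
  apply: cvgB; first by apply: cvgD => //; exact: cvg_cst.
  apply: cvgM; first exact: cvg_cst.
  apply: cvgD; first exact: cvg_cst.
  apply: cvgM; first exact: cvg_cst.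
  by apply: cvgB => //; exact: cvg_cst.
rewrite /objective -(eq_integral_measurable _ _ mE).
have le : (alpha%:E * \int[m]_(t in SB) J (density SB mu t) t <= alpha%:E * bound%:E)%E.
  rewrite lee_wpmul2l ?lee_fin ?(ltW alpha_gt0)//.
  exact: le_trans jensen (le_trans fat lim).
apply: le_trans (leeD2l _ le) _; rewrite -EFinM -EFinD lee_fin /bound.
by rewrite [alpha * _]mulrC divfK ?gt_eqF// addrC subrK.
Qed.

End Minimization.

Theorem proposition3p6 (R : realType)
  (X Xs : completeNormedModType R)
  (pairing : {bilinear X -> Xs -> R | *%R & *%R})
  (pairing_predual : is_predual pairing)
  (X_separable : separable X)
  (Y : completeNormedModType R) (ip : {dot Y for (@idfun R)})
  (Y_hilbert : is_hilbert ip)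
  (Y_separable : separable Y)
  (A : {linear X -> Y})
  (A_continuous : weak_star_weak_continuous pairing A)
  (f : Y) (alpha : R) (alpha_gt0 : 0 < alpha)
  (d : nat) (S : set 'rV[R]_d) (S_nonempty : S !=set0) (S_compact : compact S)
  (J : X -> 'rV[R]_d -> \bar R)
  (J_ge0 : forall v s, S s -> (0 <= J v s)%E)
  (J_proper : exists v s, S s /\ (J v s < +oo)%E)
  (J_borel : measurable_fun
     ([set: X] `*` S : set (borel (X * 'rV[R]_d)%type))
     ((fun p => J p.1 p.2) : borel (X * 'rV[R]_d)%type -> \bar R))
  (H1 : forall s, S s ->
     [/\ proper_efun (J ^~ s), convex_efun (J ^~ s)
       & positively_homogeneous (J ^~ s)])
  (H2 : seq_lsc (weak_star pairing) S J)
  (H3 : exists2 C : R, 0 < C &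
     forall v s, S s -> (`|v|%:E <= C%:E * J v s)%E) :
  exists2 mu : set (borel 'rV[R]_d) -> X,
    vector_measures (S : set (borel 'rV[R]_d)) mu &
    forall nu : set (borel 'rV[R]_d) -> X,
      vector_measures (S : set (borel 'rV[R]_d)) nu ->
      (objective (S : set (borel 'rV[R]_d)) A f alpha J mu <=
       objective (S : set (borel 'rV[R]_d)) A f alpha J nu)%E.
Proof.
have [s0 Ss0] := S_nonempty.
have [C C0 J_coercive] := H3.
have J_convex s : S s -> convex_efun (J ^~ s) by case/H1.
have J_homo s : S s -> positively_homogeneous (J ^~ s) by case/H1.
have J_lsc (v_ : nat -> X) (v : X) (s_ : nat -> 'rV[R]_d) (s : 'rV[R]_d) :
    (forall n, S (s_ n)) -> S s ->
    (forall u, pairing (v_ n) u @[n --> \oo] --> pairing v u) -> s_ @ \oo --> s ->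
    (J v s <= limn_einf (fun n => J (v_ n) (s_ n)))%E.
  by move=> Ss_ Ss cv cs; apply: (H2 v_ v s_ s) => //; exact: weak_star_cvg.
have mS : measurable (S : set (borel 'rV[R]_d)).
  by apply: closed_borel; apply: compact_closed => //; exact: norm_hausdorff.
pose VM := vector_measures (S : set (borel 'rV[R]_d)) : set (set (borel 'rV[R]_d) -> X).
pose obj := objective (S : set (borel 'rV[R]_d)) A f alpha J.
have obj_ge0 nu : VM nu -> (0 <= obj nu)%E.
  move=> nuvm; have [m [mE _ _ _]] := density_spec pairing_predual X_separable mS nuvm.
  rewrite /obj /objective -(eq_integral_measurable _ _ mE); apply: adde_ge0.
    by rewrite lee_fin mulr_ge0// ?invr_ge0 ?sqr_ge0.
  apply: mule_ge0; first by rewrite lee_fin ltW.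
  by apply: integral_ge0 => s Ss; exact: J_ge0.
have zero_vm : VM (fun=> 0) by exact: zero_vector_measure.
pose I := ereal_inf (obj @` VM).
have I_le nu : VM nu -> (I <= obj nu)%E.
  by move=> nuvm; apply: ereal_inf_lbound; exists nu.
have I_ge0 : (0 <= I)%E by apply: le_ereal_inf_tmp => _ [nu nuvm <-]; exact: obj_ge0.
(* If the infimum is +oo, every vector measure attains it, in particular the zero measure. Otherwise
   it is a real number and has a minimizing sequence with error 1 / (n + 1). *)
have [Ioo|Ioo] := eqVneq I +oo%E.
  exists (fun=> 0) => // nu nuvm; apply: le_trans (I_le nu nuvm).
  by rewrite Ioo leey.
have If : I \is a fin_num by rewrite ge0_fin_numE// lt_neqAle Ioo leey.
have /choice[nu nuP] : forall n, exists nu, VM nu /\ (obj nu <= (fine I + n.+1%:R^-1)%:E)%E.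
  move=> n; have n0 : 0 < n.+1%:R^-1 :> R by rewrite invr_gt0 ltr0n.
  have [_ [nu nuvm <-] lt] := lb_ereal_inf_adherent n0 If.
  by exists nu; split=> //; rewrite EFinD fineK// ltW.
have [mu muvm muI] := minimizing_limit pairing_predual X_separable Y_hilbert A_continuous
  alpha_gt0 Ss0 S_compact C0 J_ge0 J_convex J_homo J_coercive J_lsc
  (fun n => (nuP n).1) (fun n => (nuP n).2).
exists mu => // nu' nuvm'; apply: le_trans muI _.
by rewrite fineK//; exact: I_le.
Qed.
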